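(* Let $d\ge 1$ and $r\ge 2$ be integers. If $r+1$ is prime, then $t(d,r)=tt(d,r)=r$.
   Context: $t(d,r)$ is the smallest number $t$ such that for every collection $\mathcal{C}=C_0\uplus\dots\uplus C_d$ of points in $\mathbb{R}^d$ with $|C_i|\ge t$ for all $i$, there are $r$ disjoint subcollections $F_1,\dots,F_r$ of $\mathcal{C}$ satisfying (A) $|C_i\cap F_j|\le 1$ for every $i\in\{0,\dots,d\}$, $j\in\{1,\dots,r\}$, and (B) $\mathrm{conv}(F_1)\cap\dots\cap\mathrm{conv}(F_r)\ne\emptyset$. The color classes $C_i$ are allowed to be multisets of points (cardinalities and disjointness are counted with multiplicity), i.e. $\mathcal{C}$ is regarded as the family of images of the vertices of a $(|\mathcal{C}|-1)$-simplex under an affine map to $\mathbb{R}^d$. It is not required that $F_1\cup\dots\cup F_r=\mathcal{C}$. $tt(d,r)$ is the smallest number $t$ such that for every simplex $\Delta$ with $(d+1)$-colored vertex set $\mathcal{C}=C_0\uplus\dots\uplus C_d$ with $|C_i|\ge t$ for all $i$, and for every continuous map $f:\Delta\to\mathbb{R}^d$, there are $r$ disjoint faces $F_1,\dots,F_r$ of $\Delta$ satisfying (A) $|C_i\cap F_j|\le 1$ (number of vertices of $F_j$ in $C_i$) for every $i\in\{0,\dots,d\}$, $j\in\{1,\dots,r\}$, and (B) $f(F_1)\cap\dots\cap f(F_r)\ne\emptyset$. *)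

(* Defs.v *)
From mathcomp Require Import all_boot all_order all_algebra.
From mathcomp Require Import all_classical all_reals all_analysis.

Set Implicit Arguments.
Unset Strict Implicit.
Unset Printing Implicit Defensive.

Import Order.TTheory GRing.Theory Num.Theory.
Import numFieldNormedType.Exports.

Local Open Scope classical_set_scope.
Local Open Scope ring_scope.

(* A finite family of points, possibly with repetitions, is a function
   [x : T -> 'rV[R]_n] on a finite type of indices; a subcollection is a finite
   set of indices, so cardinalities and disjointness count multiplicity. *)
Definition conv_of (R : realType) (n : nat) (T : finType) (x : T -> 'rV[R]_n)
    (F : {set T}) : set 'rV[R]_n :=
  smallest (@convex_set R 'rV[R]_n) (x @` [set` F]).

Definition affinely_independent (R : realType) (n : nat) (T : finType)
    (v : T -> 'rV[R]_n) : Prop :=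
  forall a : T -> R, \sum_i a i = 0 -> \sum_i a i *: v i = 0 ->
    forall i, a i = 0.

Definition color_class (d : nat) (T : finType) (c : T -> 'I_d.+1)
    (i : 'I_d.+1) : {set T} := [set k | c k == i]%SET.

Definition disjoint_rainbow (d r : nat) (T : finType) (c : T -> 'I_d.+1)
    (F : 'I_r -> {set T}) : Prop :=
  (forall j k : 'I_r, j != k -> [disjoint F j & F k]%B) /\
  (forall (i : 'I_d.+1) (j : 'I_r), (#|color_class c i :&: F j| <= 1)%N).

Definition colored_tverberg (R : realType) (d r t : nat) : Prop :=
  forall (T : finType) (c : T -> 'I_d.+1) (x : T -> 'rV[R]_d),
    (forall i, (t <= #|color_class c i|)%N) ->
    exists F : 'I_r -> {set T}, disjoint_rainbow c F /\
      \bigcap_(j in [set: 'I_r]) conv_of x (F j) !=set0.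

(* The simplex is spanned by the affinely independent points [v i] of some
   R^n; the faces are the hulls of the subsets of its vertex set, and they are
   disjoint if and only if their vertex sets are. *)
Definition topological_colored_tverberg (R : realType) (d r t : nat) : Prop :=
  forall (T : finType) (c : T -> 'I_d.+1) (n : nat) (v : T -> 'rV[R]_n)
      (f : 'rV[R]_n -> 'rV[R]_d),
    affinely_independent v ->
    (forall i, (t <= #|color_class c i|)%N) ->
    {within conv_of v [set: T]%SET, continuous f} ->
    exists F : 'I_r -> {set T}, disjoint_rainbow c F /\
      \bigcap_(j in [set: 'I_r]) (f @` conv_of v (F j)) !=set0.

Definition is_smallest (P : nat -> Prop) (t : nat) : Prop :=
  P t /\ forall s : nat, P s -> (t <= s)%N.

(* [t(d, r) = t] and [tt(d, r) = t]; relational because the existence of the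
   smallest number is part of such an equation. *)
Definition is_t (R : realType) (d r t : nat) : Prop :=
  is_smallest (colored_tverberg R d r) t.

Definition is_tt (R : realType) (d r t : nat) : Prop :=
  is_smallest (topological_colored_tverberg R d r) t.

(* Main.v *)
Require Import Defs.
From mathcomp Require Import all_boot all_order all_fingroup all_algebra.
From mathcomp Require Import all_classical all_reals all_analysis.
From mathcomp Require Import zify ring.

(* The placements of r points of each of d + 1 colours, and of one extra point
   [None], into p = r + 1 disjoint rainbow faces form a complex on which Z/p acts
   by permuting the faces cyclically.  Without the extra point it is an orientable
   pseudomanifold L of dimension N - 1, N = (d + 1) r; with it one gets p cones
   over L.  A configuration of p points, one in each face, is mapped to the
   p x (d + 1) matrix of the weights of these points and of their weighted images
   under f.  If no configuration had all its columns constant, labelling the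
   vertices of a fine subdivision by the column of largest variation and the row
   of its maximum would give a Z/p-equivariant chain map into the join of d + 1
   boundaries of simplices with p vertices.  This target is (N - 2)-connected, so
   the degree of an equivariant chain map from L is determined modulo p; it is 0
   since the map extends to a cone over L, but r!^(d + 1) for the map given by the
   colours.  Hence some configuration has constant columns, and dropping the face
   that contains the extra point leaves r faces.

   All chain-level arguments are carried out on cochains, i.e. on arbitrary
   functions on finite sequences of vertices (including degenerate ones). The
   empty sequence makes the complexes augmented, so sequences of size n are
   simplices of dimension n - 1. *)

Set Implicit Arguments.
Unset Strict Implicit.
Unset Printing Implicit Defensive.

Import Order.TTheory GRing.Theory Num.Theory.
Import numFieldNormedType.Exports.

Local Open Scope classical_set_scope.
Local Open Scope ring_scope.

(** * Cochains and the cyclic shift *)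

Section Coboundary.
Variable F : fieldType.

(** Simplicial coboundary on arbitrary sequences; recursion on the first vertex makes the coning
    identity definitional. *)
Fixpoint delta (X : Type) (a : seq X -> F) (s : seq X) : F :=
  if s is x :: s' then a s' - delta (fun u => a (x :: u)) s' else 0.

Lemma delta_ext (X : eqType) (a b : seq X -> F) s :
  (forall u, subseq u s -> (size u).+1 = size s -> a u = b u) ->
  delta a s = delta b s.
Proof.
elim: s a b => // x s IHs a b eq_ab /=.
rewrite (eq_ab s (subseq_cons s x) erefl) (IHs _ (fun u => b (x :: u))) //.
by move=> u us su; apply: eq_ab; rewrite /= ?eqxx // su.
Qed.

Lemma delta_eq0 (X : eqType) (a : seq X -> F) s :
  (forall u, subseq u s -> (size u).+1 = size s -> a u = 0) -> delta a s = 0.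
Proof.
move=> a0; rewrite (@delta_ext _ a (fun=> 0)) //.
by elim: s {a0} => //= x s ->; rewrite subr0.
Qed.

Lemma deltaB (X : eqType) (a b : seq X -> F) s :
  delta (fun u => a u - b u) s = delta a s - delta b s.
Proof.
elim: s a b => [|x s IHs] a b /=; first by rewrite subr0.
by rewrite IHs !opprD !opprK addrACA.
Qed.

Lemma deltaD (X : eqType) (a b : seq X -> F) s :
  delta (fun u => a u + b u) s = delta a s + delta b s.
Proof.
elim: s a b => [|x s IHs] a b /=; first by rewrite addr0.
by rewrite IHs opprD addrACA.
Qed.

Lemma deltaZ (X : eqType) c (a : seq X -> F) s :
  delta (fun u => c * a u) s = c * delta a s.
Proof. by elim: s a => [|x s IHs] a /=; rewrite ?mulr0 // IHs mulrBr. Qed.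

Lemma delta_sum (X : eqType) (I : finType) (a : I -> seq X -> F) s :
  delta (fun u => \sum_i a i u) s = \sum_i delta (a i) s.
Proof.
elim: s a => [|x s IHs] a /=; first by rewrite big1.
by rewrite IHs -sumrB.
Qed.

Lemma delta_delta (X : eqType) (a : seq X -> F) s : delta (delta a) s = 0.
Proof.
elim: s a => //= x s IHs a.
by rewrite deltaB IHs subr0 subrr.
Qed.

Lemma delta_map (X Y : Type) (f : X -> Y) (a : seq Y -> F) s :
  delta (fun u => a (map f u)) s = delta a (map f s).
Proof. by elim: s a => //= x s IHs a; rewrite (IHs (fun u => a (f x :: u))). Qed.

Lemma delta_cat (X : Type) (a : seq X -> F) s w :
  delta a (s ++ w) =
  delta (fun u => a (u ++ w)) s + (-1) ^+ size s * delta (fun u => a (s ++ u)) w.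
Proof.
elim: s a => [|x s IHs] a /=; first by rewrite add0r mul1r.
by rewrite (IHs (fun u => a (x :: u))) opprD addrA exprS mulN1r mulNr.
Qed.

Lemma delta_index (X : Type) (a : seq X -> F) s :
  delta a s = \sum_(i < size s) (-1) ^+ i * a (take i s ++ drop i.+1 s).
Proof.
elim: s a => [|x s IHs] a /=; first by rewrite big_ord0.
rewrite big_ord_recl /= mul1r drop0 IHs -sumrN; congr (_ + _).
by apply: eq_bigr => i _; rewrite exprS mulN1r mulNr.
Qed.

End Coboundary.

Section Shift.
Variables (F : fieldType) (r : nat).
Local Notation Zp := 'I_r.+1.

Definition shift (Y : Type) (m : Zp) (v : Y * Zp) : Y * Zp := (v.1, v.2 + m).

Lemma shiftD (Y : Type) (m k : Zp) (v : Y * Zp) :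
  shift m (shift k v) = shift (k + m) v.
Proof. by rewrite /shift /= addrA. Qed.

Lemma shift0 (Y : Type) (v : Y * Zp) : shift 0 v = v.
Proof. by case: v => y k; rewrite /shift addr0. Qed.

Lemma shift_inj (Y : Type) (m : Zp) : injective (@shift Y m).
Proof.
move=> [y k] [y' k'] eq_s.
by have /= -> := congr1 fst eq_s; have /addIr /= -> := congr1 snd eq_s.
Qed.

Lemma map_shiftD (Y : Type) (m k : Zp) (s : seq (Y * Zp)) :
  map (shift m) (map (shift k) s) = map (shift (k + m)) s.
Proof. by rewrite -map_comp; apply: eq_map => v /=; rewrite shiftD. Qed.

Lemma map_shift0 (Y : Type) (s : seq (Y * Zp)) : map (shift 0) s = s.
Proof. by rewrite (eq_map (@shift0 _)) map_id. Qed.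

(* The two elements of [F[Z/p]] that alternate in the periodic resolution. *)
Definition step_or_norm (Y : Type) (e : bool) (a : seq (Y * Zp) -> F) s : F :=
  if e then \sum_(m : Zp) a (map (shift m) s)
  else a (map (shift (inZp 1)) s) - a s.

Lemma inZpS n : inZp n.+1 = inZp n + inZp 1 :> Zp.
Proof. by apply: val_inj; rewrite /= modnDm addn1. Qed.

Lemma step_or_norm_comp (Y : Type) e (a : seq (Y * Zp) -> F) s :
  step_or_norm e (step_or_norm (~~ e) a) s = 0.
Proof.
case: e => /=; rewrite /step_or_norm.
  rewrite sumrB [X in _ - X](reindex_inj (@addIr _ (inZp 1))) /=.
  by apply/eqP; rewrite subr_eq0; apply/eqP/eq_bigr => m _; rewrite map_shiftD.
rewrite [X in _ - X](reindex_inj (@addrI _ (inZp 1))) /=.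
by apply/eqP; rewrite subr_eq0; apply/eqP/eq_bigr => m _; rewrite map_shiftD.
Qed.

Lemma step_or_norm_delta (Y : eqType) e (a : seq (Y * Zp) -> F) s :
  step_or_norm e (delta a) s = delta (step_or_norm e a) s.
Proof.
case: e; rewrite /step_or_norm.
  by rewrite delta_sum; apply: eq_bigr => m _; rewrite delta_map.
by rewrite deltaB delta_map.
Qed.

(* The shifts act freely on nonempty sequences, so that the cochains on them
   form an induced, hence cohomologically trivial, module. *)
Lemma step_or_norm_exact (Y : Type) e (a : seq (Y * Zp) -> F) :
  exists c, forall s, (0 < size s)%N ->
    (forall m, step_or_norm e a (map (shift m) s) = 0) ->
    a s = step_or_norm (~~ e) c s.
Proof.
pose chi (s : seq (Y * Zp)) : Zp := if s is v :: _ then v.2 else 0.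
have chi_shift m s : (0 < size s)%N -> chi (map (shift m) s) = chi s + m.
  by case: s.
case: e => /=; rewrite /step_or_norm.
  (* Partial sums of [a] along the orbit, over the translates whose first row precedes that of [s].
     Consecutive ones differ by a value of [a]; the vanishing norm covers the wrap-around. *)
  exists (fun s => \sum_(i < chi s) a (map (shift (inZp i - chi s)) s)).
  move=> s s_gt0 Na0; rewrite chi_shift //.
  set k := chi s; pose phi (m : Zp) := a (map (shift (m - k)) s).
  rewrite [in LHS](_ : a s = phi k); last by rewrite /phi subrr map_shift0.
  under eq_bigr => i _.
    rewrite map_shiftD (_ : inZp 1 + _ = inZp i - k); last first.
      by rewrite opprD addrC -addrA -addrA addNr addr0.
    over.
  rewrite -/(\sum_(i < k) phi (inZp i)).
  have sum_phi : \sum_(i < r.+1) phi (inZp i) = 0.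
    have := Na0 0; rewrite map_shift0 (reindex_inj (@addIr _ (- k))) /=.
    by move=> sum0; rewrite -[RHS]sum0; apply: eq_bigr => i _; rewrite valZpK.
  have [k_max|k_lt] := eqVneq (val k) r.
    have -> : k + inZp 1 = 0 by apply: val_inj; rewrite /= modnDmr k_max addn1 modnn.
    rewrite big_ord0 sub0r k_max; apply/eqP; rewrite -addr_eq0 addrC.
    move: sum_phi; rewrite big_ord_recr /= => /eqP.
    by rewrite (_ : inZp r = k) //; apply: val_inj; rewrite /= k_max modn_small.
  have -> : val (k + inZp 1) = k.+1.
    rewrite /= modnDmr addn1 modn_small // ltnS ltn_neqAle k_lt /=.
    by rewrite -ltnS ltn_ord.
  by rewrite big_ord_recr /= addrAC subrr add0r valZpK.
(* Every orbit has exactly one member whose first vertex is in row 0; an invariant [a] is the norm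
   of its restriction to these members. *)
exists (fun s => if chi s == 0 then a s else 0) => s s_gt0 Da0.
have inv_nat n : a (map (shift (inZp n)) s) = a s.
  elim: n => [|n IHn].
    rewrite -[in RHS](map_shift0 s); congr (a (map (shift _) s)).
    by apply: val_inj; rewrite /= mod0n.
  rewrite inZpS -map_shiftD -[RHS]IHn; apply/eqP; rewrite -subr_eq0.
  exact/eqP/Da0.
have inv m : a (map (shift m) s) = a s by rewrite -(valZpK m) inv_nat.
rewrite (bigD1 (- chi s)) //= big1 => [|m].
  by rewrite chi_shift // subrr eqxx inv addr0.
rewrite chi_shift //; case: ifP => // /eqP /eqP.
by rewrite addrC addr_eq0 => ->.
Qed.

End Shift.

(** * Signs of bijective sequences *)

Section Incidence.
Variables (F : fieldType) (V : finType) (v0 : V).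

(* Locked, lest unification compare determinants by computing them. *)
Fact incidence_det_key : unit. Proof. by []. Qed.
Definition incidence_det : seq V -> F := locked_with incidence_det_key
  (fun s => \det (\matrix_(i < #|V|, j < #|V|) (nth v0 s i == enum_val j)%:R)).

Lemma incidence_detE s : incidence_det s =
  \det (\matrix_(i < #|V|, j < #|V|) (nth v0 s i == enum_val j)%:R).
Proof. by rewrite /incidence_det locked_withE. Qed.

(** [incidence_det] is the sign of an ordering of [V]. The alternating sum is the expansion, along a
    column of ones, of a matrix in which that column is the sum of the others. *)
Lemma delta_incidence_det s : size s = #|V|.+1 -> delta incidence_det s = 0.
Proof.
move=> size_s; rewrite delta_index size_s.
pose B := \matrix_(i < #|V|.+1, j < #|V|.+1)
  (if unlift ord0 j is Some j' then (nth v0 s i == enum_val j')%:R else 1 : F).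
have detB : \det B = 0.
  rewrite -det_tr; apply/eqP/det0P.
  exists (\row_j (if unlift ord0 j is Some _ then - 1 else 1)).
    apply/eqP => /rowP/(_ ord0); rewrite !mxE unlift_none => /eqP.
    by rewrite oner_eq0.
  apply/rowP => i; rewrite !mxE big_ord_recl !mxE unlift_none mul1r.
  rewrite (bigD1 (enum_rank (nth v0 s i))) //= !mxE liftK enum_rankK eqxx mulr1.
  rewrite big1 ?addr0 ?subrr // => j ne_j; rewrite !mxE liftK.
  case: eqVneq => [nth_j|_]; last by rewrite mulr0.
  by rewrite nth_j enum_valK eqxx in ne_j.
rewrite -[RHS]detB (expand_det_col B ord0); apply: eq_bigr => i _.
rewrite !mxE unlift_none mul1r /cofactor addn0 incidence_detE; congr (_ * \det _).
apply/matrixP => k j; rewrite !mxE liftK.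
congr (_ == _)%:R; rewrite nth_cat size_takel; last by rewrite size_s ltnW.
rewrite /= /bump; case: leqP => [le_ik|lt_ki]; last by rewrite nth_take.
by rewrite nth_drop addSn subnKC // add1n.
Qed.

Lemma incidence_det_miss v s : size s = #|V| -> v \notin s -> incidence_det s = 0.
Proof.
move=> size_s v_s; rewrite !incidence_detE -det_tr; apply/eqP/det0P.
exists (delta_mx 0 (enum_rank v)).
  apply/eqP => /rowP/(_ (enum_rank v)); rewrite !mxE !eqxx => /eqP.
  by rewrite oner_eq0.
apply/rowP => i; rewrite -rowE !mxE enum_rankK; case: eqP => // nth_v.
by rewrite -nth_v mem_nth // size_s in v_s.
Qed.

Lemma incidence_det_dup s :
  size s = #|V| -> ~~ uniq s -> incidence_det s = 0.
Proof.
move=> size_s dup_s; have [v v_s|all_s] := pickP [pred v | v \notin s].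
  exact: incidence_det_miss v_s.
case/negP: dup_s; apply/card_uniqP; rewrite size_s; apply: eq_card => v.
by have /negbFE := all_s v.
Qed.

(** The incidence matrix of an ordering is a permutation matrix, so its transpose is its inverse. *)
Lemma incidence_det_uniq s :
  size s = #|V| -> uniq s -> incidence_det s * incidence_det s = 1.
Proof.
move=> size_s uniq_s; rewrite !incidence_detE -[X in _ * X]det_tr -det_mulmx.
rewrite -[RHS](det1 _ #|V|); congr (\det _); apply/matrixP => i j; rewrite !mxE.
rewrite (bigD1 (enum_rank (nth v0 s i))) //= !mxE enum_rankK eqxx mul1r.
rewrite nth_uniq ?size_s // eq_sym big1 ?addr0 // => k ne_k; rewrite !mxE.
case: eqP => [nth_k|_]; last by rewrite mul0r.
by rewrite nth_k enum_valK eqxx in ne_k.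
Qed.

(* An odd number of iterations of [f] gives the identity, hence [f] permutes
   the columns evenly. *)
Lemma incidence_det_map (f : V -> V) n s :
  injective f -> odd n -> (forall v, iter n f v = v) -> size s = #|V| ->
  incidence_det (map f s) = incidence_det s.
Proof.
move=> inj_f odd_n iter_f size_s.
have inj_g : injective (fun j : 'I_#|V| => enum_rank (f (enum_val j))).
  by move=> i j /enum_rank_inj /inj_f /enum_val_inj.
pose g := perm inj_g.
have even_g : odd_perm g = false.
  have gn1 : (g ^+ n = 1)%g.
    apply/permP => j; rewrite perm1 permX; apply: enum_val_inj.
    rewrite -[RHS]iter_f; elim: n {odd_n iter_f} => //= n IHn.
    by rewrite permE enum_rankK IHn.
  have := congr1 (@odd_perm _) gn1; rewrite odd_perm1.
  have odd_gX k : (g ^+ k)%g = odd k && g :> bool.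
    elim: k => [|k IHk]; first by rewrite expg0 odd_perm1.
    by rewrite expgS odd_permM IHk /=; case: (odd k); case: (odd_perm g).
  by rewrite odd_gX odd_n.
rewrite !incidence_detE; set A := (X in _ = \det X).
rewrite (_ : (\matrix_(i, j) _) = A *m perm_mx g).
  by rewrite det_mulmx det_perm even_g mulr1.
apply/matrixP => i j; rewrite -[perm_mx g]trmxK tr_perm_mx !mxE.
rewrite (bigD1 (g^-1 j)%g) //= !mxE eqxx mulr1 big1 ?addr0.
  rewrite (nth_map v0) ?size_s //; congr (nat_of_bool _)%:R.
  rewrite -{1}(permKV g j) {1}permE enum_rankK.
  by rewrite (inj_eq inj_f).
by move=> k ne_k; rewrite !mxE [_ == k]eq_sym (negPf ne_k) mulr0.
Qed.

Lemma incidence_det_tperm (I : eqType) (E : seq I) (f g : I -> V) x y :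
  uniq E -> size E = #|V| -> x \in E -> y \in E -> x != y ->
  g x = f y -> g y = f x -> (forall z, z != x -> z != y -> g z = f z) ->
  incidence_det (map g E) = - incidence_det (map f E).
Proof.
move=> uniq_E size_E xE yE ne_xy gx gy gz.
have ltx : (index x E < #|V|)%N by rewrite -size_E index_mem.
have lty : (index y E < #|V|)%N by rewrite -size_E index_mem.
pose i := Ordinal ltx; pose j := Ordinal lty.
have ne_ij : i != j.
  apply/negP => /eqP/(congr1 val) /= eq_i.
  by rewrite -(nth_index x xE) eq_i nth_index // eqxx in ne_xy.
rewrite !incidence_detE; set A := (X in - \det X).
rewrite (_ : (\matrix_(k, l) _) = tperm_mx i j *m A).
  by rewrite det_mulmx det_perm odd_tperm ne_ij mulN1r.
rewrite -xrowE; apply/matrixP => k l; rewrite !mxE !(nth_map x) ?size_E //.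
congr (_ == _)%:R; case: tpermP => [->|->|ne_ki ne_kj] /=.
- by rewrite !nth_index.
- by rewrite !nth_index.
apply: gz; apply/eqP => nth_k; [case: ne_ki | case: ne_kj];
  by apply: val_inj; rewrite /= -nth_k index_uniq // size_E.
Qed.

End Incidence.

(** * The complex of labels *)

Section Target.
Variables (F : fieldType) (d r : nat).
Local Notation Zp := 'I_r.+1.
Local Notation label := ('I_d.+1 * 'I_r.+1)%type.
Local Notation cochain X := (seq X -> F).

(** The simplices of the join of [d.+1] boundaries of simplices, one for each column, with the rows
    as vertices. *)
Definition no_full_column (s : seq label) : bool :=
  [forall l, exists k, (l, k) \notin s].

Lemma no_full_columnP s :
  reflect (forall l, exists k, (l, k) \notin s) (no_full_column s).
Proof. by apply: (iffP forallP) => nf l; apply/existsP; apply: nf. Qed.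

Lemma no_full_column_sub (s u : seq label) :
  {subset u <= s} -> no_full_column s -> no_full_column u.
Proof.
move=> us /no_full_columnP nf; apply/no_full_columnP => l.
by have [k lk_s] := nf l; exists k; apply: contra lk_s; apply: us.
Qed.

Lemma no_full_column_shift m (s : seq label) :
  no_full_column s -> no_full_column (map (shift m) s).
Proof.
move=> /no_full_columnP nf; apply/no_full_columnP => l.
have [k lk_s] := nf l; exists (k + m).
by rewrite -[(l, _)]/(shift m (l, k)) mem_map //; apply: shift_inj.
Qed.

(** A filtration by [j]; at [j = d.+1] only the sequences containing the facet of all labels in
    nonzero rows are excluded. *)
Let misses (j : nat) (s : seq label) : bool :=
  [exists v : label, [&& (v.1 < j)%N, v.2 != 0 & v \notin s]].

Let misses_sub j (s u : seq label) : {subset u <= s} -> misses j s -> misses j u.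
Proof.
move=> us /existsP[v /and3P[vj v0 v_s]]; apply/existsP; exists v.
by rewrite vj v0; apply: contra v_s; apply: us.
Qed.

(* The complex without full columns, deprived of the facet
   [{(l, k) | k <> 0}], is built up by successively coning off with apexes
   [(0, 0), (1, 0), ...]. *)
Let acyclic_misses j n (b : cochain label) :
  (forall s, no_full_column s -> misses j s -> size s = n.+1 -> delta b s = 0) ->
  exists a, forall s, no_full_column s -> misses j s -> size s = n ->
    delta a s = b s.
Proof.
elim: j => [|j IHj] db0.
  by exists b => s _ /existsP[v].
have missesS s : misses j s -> misses j.+1 s.
  move=> /existsP[v /and3P[vj v0 v_s]]; apply/existsP; exists v.
  by rewrite v0 v_s (ltn_trans vj).
have [lt_jd|le_dj] := ltnP j d.+1; last first.
  have [|a da] := IHj; first by move=> s nf /missesS; apply: db0.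
  exists a => s nf /existsP[v /and3P[_ v0 v_s]]; apply: da => //.
  by apply/existsP; exists v; rewrite v0 v_s (leq_trans (ltn_ord _)).
have [|a1 da1] := IHj; first by move=> s nf /missesS; apply: db0.
pose lj : 'I_d.+1 := Ordinal lt_jd.
(* The cells added at this stage. [b1] is the defect of the primitive [a1] on them, to be corrected
   through the cone with apex [(lj, 0)]. *)
pose new s := [&& no_full_column s, misses j.+1 s & ~~ misses j s].
pose b1 s := if new s then b s - delta a1 s else 0.
exists (fun s => a1 s + b1 ((lj, 0) :: s)) => s nf mis size_s.
rewrite deltaD; have [mis_j|mis'_j] := boolP (misses j s).
  rewrite da1 // -[RHS]addr0; congr (_ + _).
  have -> : delta (fun u => b1 ((lj, 0) :: u)) s =
            b1 s - delta b1 ((lj, 0) :: s) by rewrite /= opprB addrC subrK.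
  rewrite {1}/b1 /new mis_j !andbF sub0r delta_eq0 ?oppr0 // => u u_sub _.
  rewrite /b1 ifN // /new negb_and -implybE; apply/implyP => nf_u.
  rewrite negb_and negbK orbC (_ : misses j u) //.
  have /existsP[v /and3P[vj v0 v_s]] := mis_j; apply/existsP; exists v.
  rewrite vj v0; apply: contra v_s => /(mem_subseq u_sub); rewrite inE.
  by case: eqP => // v_lj; rewrite v_lj ltnn in vj.
have [v /and3P[vj v0 v_s]] := existsP mis.
have v1 : v.1 = lj.
  apply/val_inj/eqP; rewrite eqn_leq -ltnS vj leqNgt /=.
  by apply: contra mis'_j => vj'; apply/existsP; exists v; rewrite vj' v0.
(* The apex can be joined to [s]: the label [v] of column [lj], not being in row 0, remains
   missing. *)
have nf' : no_full_column ((lj, 0) :: s).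
  apply/no_full_columnP => l; have [->|ne_l] := eqVneq l lj.
    exists v.2; rewrite -v1 -surjective_pairing inE negb_or v_s andbT.
    by apply: contra v0 => /eqP->.
  have [k lk_s] := no_full_columnP _ nf l; exists k.
  by rewrite inE negb_or lk_s xpair_eqE negb_and ne_l.
have mis' : misses j.+1 ((lj, 0) :: s).
  apply/existsP; exists v; rewrite vj v0 inE negb_or v_s andbT /=.
  by apply: contra v0 => /eqP->.
have -> : delta (fun u => b1 ((lj, 0) :: u)) s =
          b1 s - delta b1 ((lj, 0) :: s) by rewrite /= opprB addrC subrK.
rewrite (_ : delta b1 _ = 0) ?subr0.
  by rewrite /b1 /new nf mis mis'_j addrC subrK.
(* On the faces of the cone [b1] agrees with the cocycle [b - delta a1], since [a1] has no defect on
   the old ones. *)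
rewrite (@delta_ext _ _ _ (fun u => b u - delta a1 u)).
  by rewrite deltaB delta_delta subr0; apply: db0; rewrite //= size_s.
move=> u /mem_subseq u_sub; rewrite /= size_s => -[size_u].
have nf_u := no_full_column_sub u_sub nf'.
rewrite /b1 /new nf_u (misses_sub u_sub mis') /=.
by case: ifP => // /negbFE mis_u; rewrite da1 // subrr.
Qed.

(** A sequence with fewer than [d.+1 * r] entries cannot contain the deleted facet. *)
Lemma acyclic_low n (b : cochain label) : (n < d.+1 * r)%N ->
  (forall s, no_full_column s -> size s = n.+1 -> delta b s = 0) ->
  exists a, forall s, no_full_column s -> size s = n -> delta a s = b s.
Proof.
move=> lt_n db0; have [|a da] := @acyclic_misses d.+1 n b.
  by move=> s nf _; apply: db0.
exists a => s nf size_s; apply: da => //; apply: contraLR lt_n => full.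
rewrite -leqNgt -size_s.
have -> : (d.+1 * r)%N = #|[predX 'I_d.+1 & predC1 (0 : Zp)]|.
  by rewrite cardX cardC1 !card_ord.
apply: leq_trans (card_size s); apply/subset_leq_card/fintype.subsetP => v.
rewrite !inE /= => v0; apply: contraR full => v_s.
by apply/existsP; exists v; rewrite ltn_ord v0.
Qed.

Hypothesis odd_r : odd r.+1.

Local Notation det := (@incidence_det F label (ord0, ord0)).

Definition border (kappa : 'I_d.+1 -> Zp) : seq label :=
  [seq (l, kappa l) | l <- enum 'I_d.+1].

Lemma size_border kappa : size (border kappa) = d.+1.
Proof. by rewrite size_map size_enum_ord. Qed.

Lemma card_label : #|{: label}| = (d.+1 * r + d.+1)%N.
Proof. by rewrite card_prod !card_ord mulnSr. Qed.

Lemma det_shift m s :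
  size s = #|{: label}| -> det (map (shift m) s) = det s.
Proof.
move=> size_s; apply: (@incidence_det_map _ _ _ _ r.+1) => //.
  exact: shift_inj.
have iter_shift n (v : label) : iter n (shift m) v = (v.1, v.2 + m *+ n).
  elim: n => [|n IHn]; first by rewrite addr0; case: v.
  by rewrite /= IHn /shift /= mulrSr addrA.
move=> v; rewrite iter_shift (_ : m *+ r.+1 = 0) ?addr0; first by case: v.
by rewrite Zp_mulrn; apply: val_inj; rewrite /= modnMl.
Qed.

Lemma det_no_full_column s w l :
  no_full_column s -> size (s ++ w) = #|{: label}| -> l \notin map fst w ->
  det (s ++ w) = 0.
Proof.
move=> /no_full_columnP/(_ l) [k lk_s] size_sw l_w.
apply: (@incidence_det_miss _ _ _ (l, k)) => //.
rewrite mem_cat negb_or lk_s; apply: contra l_w => lk_w.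
by apply/mapP; exists (l, k).
Qed.

Lemma det_no_full_column_dup s w :
  no_full_column s -> size s = (d.+1 * r)%N -> size w = d.+1 ->
  ~~ uniq (map fst w) -> det (s ++ w) = 0.
Proof.
move=> nf size_s size_w dup_w.
have [l l_w|all_w] := pickP [pred l | l \notin map fst w].
  by apply: det_no_full_column l_w; rewrite // size_cat size_s size_w card_label.
case/negP: dup_w; apply/card_uniqP; rewrite size_map size_w -[RHS]card_ord.
by apply: eq_card => l; have /negbFE := all_w l.
Qed.

(** On sequences of size [d.+1 * r], the signed indicator of the orderings of the facet that omits
    row [kappa l] in each column [l]. *)
Definition facet_cochain (kappa : 'I_d.+1 -> Zp) : cochain label :=
  fun s => det (s ++ border kappa).

Lemma delta_facet_cochain kappa s :
  no_full_column s -> size s = (d.+1 * r).+1 ->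
  delta (facet_cochain kappa) s = 0.
Proof.
move=> nf size_s; have := delta_cat det s (border kappa).
rewrite (@delta_incidence_det F _ (ord0, ord0) (s ++ border kappa)); last first.
  by rewrite size_cat size_s size_border card_label.
rewrite (delta_eq0 (s := border kappa)) ?mulr0 ?addr0 // => u.
move=> _; rewrite size_border => -[size_u].
have [l l_u|all_u] := pickP [pred l | l \notin map fst u].
  apply: det_no_full_column l_u; rewrite // size_cat size_s size_u card_label.
  by rewrite addSnnS.
have : (#|'I_d.+1| <= #|map fst u|)%N.
  by apply/subset_leq_card/fintype.subsetP => l _; have /negbFE := all_u l.
by rewrite leqNgt card_ord ltnS (leq_trans (card_size _)) // size_map size_u.
Qed.

(** Facets omitting different labels of column [l] share a ridge, whose signed indicator is the
    primitive: [w] lists the labels missing from the ridge, and among the deletions from [w] only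
    those of [X] and [Y] survive. *)
Let facet_cochain_update l kappa kappa' :
  (forall l', l' != l -> kappa' l' = kappa l') ->
  exists b, forall s, no_full_column s -> size s = (d.+1 * r)%N ->
    facet_cochain kappa' s - facet_cochain kappa s = delta b s.
Proof.
move=> eq_kappa; have l_enum : l \in enum 'I_d.+1 by rewrite mem_enum.
have := enum_uniq 'I_d.+1; have := size_enum_ord d.+1.
rewrite /facet_cochain /border.
case/splitPr: l_enum => E1 E2 size_E uniq_E.
have [lE1 lE2] : l \notin E1 /\ l \notin E2.
  by move: uniq_E; rewrite uniq_catC /= mem_cat negb_or => /andP[/andP[]].
pose K l' := (l', kappa l').
have eqE (E : seq 'I_d.+1) : l \notin E ->
    [seq (l', kappa' l') | l' <- E] = map K E.
  move=> lE; apply/eq_in_map => l' l'E; rewrite eq_kappa //.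
  by apply: contraNneq lE => <-.
rewrite !map_cat /= !eqE // -/K; set X := (l, kappa' l); set Y := (l, kappa l).
pose w := map K E1 ++ Y :: X :: map K E2.
have size_E' : (size E1 + size E2).+1 = d.+1 by move: size_E; rewrite size_cat /= addnS.
have size_w : size w = d.+2 by rewrite size_cat /= !size_map !addnS size_E'.
exists (fun u => - (-1) ^+ (d.+1 * r + size E1) * det (u ++ w)) => s nf size_s.
have := delta_cat det s w.
rewrite (@delta_incidence_det F _ (ord0, ord0) (s ++ w)); last first.
  by rewrite size_cat size_s size_w card_label addnS.
have fst_dup (u1 u2 : seq label) : ~~ uniq (map fst (u1 ++ Y :: X :: u2)).
  by rewrite map_cat uniq_catC /= inE eqxx.
rewrite {2}/w delta_cat (delta_eq0 (s := map K E1)); last first.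
  move=> u _; rewrite size_map => size_u; apply: det_no_full_column_dup => //.
  by apply: etrans size_E'; rewrite size_cat /= size_map -size_u !addnS addSn.
rewrite add0r /= (delta_eq0 (s := map K E2)); last first.
  move=> u _; rewrite size_map => size_u; apply: det_no_full_column_dup => //.
  by apply: etrans size_E'; rewrite size_cat /= size_map -size_u !addnS.
rewrite subr0 deltaZ size_s !size_map mulrA -exprD => /esym/eqP.
rewrite addrC addr_eq0 => /eqP eqD.
by rewrite mulNr -mulrN -eqD mulrA -exprD -signr_odd oddD addbb mul1r.
Qed.

Let facet_cochain_cohomologous kappa kappa' :
  exists b, forall s, no_full_column s -> size s = (d.+1 * r)%N ->
    facet_cochain kappa' s - facet_cochain kappa s = delta b s.
Proof.
suff upd (E : seq 'I_d.+1) : forall kappa, (forall l, l \notin E -> kappa' l = kappa l) ->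
    exists b, forall s, no_full_column s -> size s = (d.+1 * r)%N ->
      facet_cochain kappa' s - facet_cochain kappa s = delta b s.
  by apply: (upd (enum 'I_d.+1)) => l; rewrite mem_enum.
elim: E => [|l E IHE] {}kappa eq_kappa.
  exists (fun=> 0) => s _ _; rewrite /facet_cochain /border.
  rewrite (eq_map (g := fun l => (l, kappa l))) => [|l].
    by rewrite subrr delta_eq0.
  by rewrite eq_kappa.
pose kappa1 l' := if l' == l then kappa' l else kappa l'.
have [|b1 db1] := IHE kappa1.
  move=> l' l'E; rewrite /kappa1; case: eqVneq => [->//|ne_l].
  by rewrite eq_kappa // inE negb_or ne_l.
have [|b2 db2] := @facet_cochain_update l kappa kappa1.
  by move=> l' ne_l; rewrite /kappa1 (negPf ne_l).
exists (fun s => b1 s + b2 s) => s nf size_s.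
by rewrite deltaD -db1 // -db2 // addrA subrK.
Qed.

(** By invariance of the sign, shifting the argument amounts to shifting the border back, which
    changes the cochain by a coboundary: the group fixes its class. *)
Lemma step_facet_cochain :
  exists b, forall s, no_full_column s -> size s = (d.+1 * r)%N ->
    step_or_norm false (facet_cochain (fun=> 0)) s = delta b s.
Proof.
have [b db] := facet_cochain_cohomologous (fun=> 0) (fun=> - inZp 1).
exists b => s nf size_s; rewrite -db //; congr (_ - _).
rewrite /facet_cochain -(@det_shift (inZp 1) (s ++ border _)); last first.
  by rewrite size_cat size_s size_border card_label.
rewrite map_cat; congr (det (_ ++ _)); rewrite /border -[RHS]map_comp.
by apply: eq_map => l; rewrite /= /shift addNr.
Qed.

(* [theta] is the difference of two chain maps. Degree by degree it is seen to
   be a coboundary modulo norms (or modulo the image of [shift - 1]). *)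
Section Ladder.
Variables (Y : eqType) (L : seq (Y * Zp) -> bool).
Variable theta : cochain label -> cochain (Y * Zp).
Hypothesis L_sub : forall s u, subseq u s -> L s -> L u.
Hypothesis L_shift : forall m s, L s -> L (map (shift m) s).
Hypothesis theta_local : forall a b s, L s ->
  (forall u, no_full_column u -> size u = size s -> a u = b u) ->
  theta a s = theta b s.
Hypothesis thetaB : forall a b s,
  theta (fun u => a u - b u) s = theta a s - theta b s.
Hypothesis theta_sum : forall (I : finType) (a : I -> cochain label) s,
  theta (fun u => \sum_i a i u) s = \sum_i theta (a i) s.
Hypothesis theta_delta : forall a s, theta (delta a) s = delta (theta a) s.
Hypothesis theta_shift : forall m a s, L s ->
  theta (fun u => a (map (shift m) u)) s = theta a (map (shift m) s).
Hypothesis theta_nil : forall a, theta a [::] = 0.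

Let theta_step_or_norm e a s : L s ->
  theta (step_or_norm e a) s = step_or_norm e (theta a) s.
Proof.
move=> Ls; case: e; rewrite /step_or_norm.
  by rewrite theta_sum; apply: eq_bigr => m _; apply: theta_shift.
by rewrite thetaB theta_shift.
Qed.

(** One rung: [step_or_norm e] kills [theta a - delta c], since it turns [theta a] into
    [delta (theta a')], which equals [delta (step_or_norm e c)]. Exactness then gives [c']. *)
Let ladder_step n e a a' b c :
  (forall s, no_full_column s -> size s = n.+1 ->
    step_or_norm e a s = delta a' s) ->
  (forall s, L s -> size s = n ->
    theta a' s = delta b s + step_or_norm e c s) ->
  exists b c', forall s, L s -> size s = n.+1 ->
    theta a s = delta b s + step_or_norm (~~ e) c' s.
Proof.
move=> da' theta_a'.
have [c' c'P] := step_or_norm_exact e (fun s => theta a s - delta c s).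
exists c, c' => s Ls size_s; apply/eqP; rewrite addrC -subr_eq; apply/eqP.
apply: c'P => [|m]; first by rewrite size_s.
have {Ls} := L_shift m Ls; have : size (map (shift m) s) = n.+1 by rewrite size_map.
move: (map _ s) => {size_s m}s size_s Ls.
have -> : step_or_norm e (fun u => theta a u - delta c u) s =
    step_or_norm e (theta a) s - step_or_norm e (delta c) s.
  by case: (e); rewrite /step_or_norm ?sumrB // !opprD !opprK addrACA.
rewrite -theta_step_or_norm // (@theta_local _ (delta a')) => [|//|u nf size_u]; last first.
  by apply: da'; rewrite ?size_u.
rewrite theta_delta step_or_norm_delta.
rewrite (@delta_ext _ _ (theta a') (fun u => delta b u + step_or_norm e c u)).
  by rewrite deltaD delta_delta add0r subrr.
move=> u us; rewrite size_s => -[size_u].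
by apply: theta_a' => //; apply: L_sub us Ls.
Qed.

(** Induction on the size: acyclicity provides [a'] with coboundary [step_or_norm e a], and the
    other operator makes a cocycle of [a']. In size 0 [theta] vanishes. *)
Let ladder n e a : (n < d.+1 * r)%N ->
  (forall s, no_full_column s -> size s = n.+1 ->
    delta (step_or_norm e a) s = 0) ->
  exists b c, forall s, L s -> size s = n ->
    theta a s = delta b s + step_or_norm (~~ e) c s.
Proof.
elim: n e a => [|n IHn] e a lt_n da.
  exists (fun=> 0), (fun=> 0) => s _ /size0nil ->.
  by rewrite theta_nil add0r /step_or_norm; case: e {da} => /=; rewrite ?subrr ?big1.
have [a' da'] := acyclic_low lt_n da.
have [|b [c]] := IHn (~~ e) a' (ltnW lt_n).
  move=> s nf size_s; rewrite -step_or_norm_delta -[RHS](step_or_norm_comp (~~ e) a s).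
  rewrite negbK; case: (e) da' => da'; rewrite /step_or_norm /=.
    by rewrite !da' ?size_map // no_full_column_shift.
  by apply: eq_bigr => m _; rewrite da' ?size_map // no_full_column_shift.
rewrite negbK => theta_a'; apply: ladder_step theta_a' => s nf size_s.
by rewrite da'.
Qed.

Lemma ladder_top : (0 < d.+1 * r)%N ->
  exists b c, forall s, L s -> size s = (d.+1 * r)%N ->
    theta (facet_cochain (fun=> 0)) s = delta b s + step_or_norm true c s.
Proof.
have [a' da'] := step_facet_cochain; case E : (d.+1 * r)%N da' => [//|n] da' _.
have [|s nf size_s|b [c theta_a']] := @ladder n true a'; first by rewrite E.
  rewrite -step_or_norm_delta /step_or_norm.
  rewrite -[RHS](step_or_norm_comp true (facet_cochain (fun=> 0)) s).
  by apply: eq_bigr => m _; rewrite -da' ?size_map // no_full_column_shift.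
exact: ladder_step da' theta_a'.
Qed.

End Ladder.

End Target.

(** * The complex of configurations *)

Section ConfigurationComplex.
Variables (F : fieldType) (d r : nat).
Hypotheses (r_gt0 : (0 < r)%N) (odd_r : odd r.+1).
Local Notation Zp := 'I_r.+1.
Local Notation label := ('I_d.+1 * 'I_r.+1)%type.
Local Notation color_index := ('I_d.+1 * 'I_r)%type.
Local Notation vertex := (option ('I_d.+1 * 'I_r) * 'I_r.+1)%type.
Local Notation cochain X := (seq X -> F).

(* The vertex [(t, k)] puts the point [t] into the [k]-th face. *)
Definition conflict (v w : vertex) : bool :=
  match v.1, w.1 with
  | Some t, Some t' => (t.1 == t'.1) && ((t == t') != (v.2 == w.2))
  | None, None => v.2 != w.2
  | _, _ => false
  end.

Definition is_cell (s : seq vertex) : bool :=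
  all (fun v => all (fun w => ~~ conflict v w) s) s.

Lemma is_cellP s :
  reflect {in s &, forall v w, ~~ conflict v w} (is_cell s).
Proof.
apply: (iffP allP) => [all_s v w vs ws|cell_s v vs]; first exact: (allP (all_s v vs)).
by apply/allP => w ws; apply: cell_s.
Qed.

Lemma is_cell_sub (s u : seq vertex) : {subset u <= s} -> is_cell s -> is_cell u.
Proof. by move=> us /is_cellP cs; apply/is_cellP => v w /us + /us; apply: cs. Qed.

Lemma conflict_shift m v w : conflict (shift m v) (shift m w) = conflict v w.
Proof.
rewrite /conflict /=; case: v.1 => [t|]; case: w.1 => [t'|] //;
  by rewrite (inj_eq (@addIr _ m)).
Qed.

Lemma is_cell_shift m s : is_cell s -> is_cell (map (shift m) s).
Proof.
move=> /is_cellP cs; apply/is_cellP => _ _ /mapP[v vs ->] /mapP[w ws ->].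
by rewrite conflict_shift cs.
Qed.

Definition color_label (v : vertex) : label :=
  (if v.1 is Some t then t.1 else ord0, v.2).

Definition is_base_cell (s : seq vertex) : bool :=
  is_cell s && all (fun v => isSome v.1) s.

(** Pigeonhole: [r] points of one colour, each in one face, cannot occupy all [r.+1] faces. *)
Lemma color_label_no_full_column s :
  is_base_cell s -> no_full_column (map color_label s).
Proof.
move=> /andP[/is_cellP cell_s /allP some_s]; apply/no_full_columnP => l.
apply/existsP; apply: contraT; rewrite negb_exists => /forallP full.
have /fin_all_exists[i i_s] k : exists i : 'I_r, (Some (l, i), k) \in s.
  have /negbNE/mapP[[t k'] ts] := full k; have := some_s _ ts.
  by case: t ts => [[l' i]|//] ts _ [-> ->]; exists i.
suff /leq_card : injective i by rewrite !card_ord ltnn.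
move=> k k' eq_i; apply/eqP; apply: contraT => ne_k.
have := cell_s _ _ (i_s k) (i_s k'); rewrite /conflict /= eqxx eq_i eqxx.
by rewrite eq_sym (negPf ne_k).
Qed.

Local Notation placement := {ffun 'I_d.+1 -> {ffun 'I_r -> 'I_r.+1}}.

Definition cell_of (J : placement) : seq vertex :=
  [seq (Some t, J t.1 t.2) | t <- enum {: color_index}].

Definition labels_of (J : placement) : seq label :=
  [seq (t.1, J t.1 t.2) | t <- enum {: color_index}].

Local Notation det := (@incidence_det F label (ord0, ord0)).

Definition weight (J : placement) (kappa : {ffun 'I_d.+1 -> Zp}) : F :=
  det (labels_of J ++ border kappa).

(* The value of [b] on the fundamental cycle.  Its coefficients need no explicit
   signs: [weight] vanishes unless [kappa] lists the rows missed by [J]. *)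
Definition fundamental (b : cochain vertex) : F :=
  \sum_J \sum_kappa weight J kappa * b (cell_of J).

Lemma size_cell_of J : size (cell_of J) = (d.+1 * r)%N.
Proof. by rewrite size_map -cardE card_prod !card_ord. Qed.

Lemma map_color_label_cell_of J : map color_label (cell_of J) = labels_of J.
Proof. by rewrite -map_comp. Qed.

Lemma size_labels_of J : size (labels_of J) = (d.+1 * r)%N.
Proof. by rewrite -map_color_label_cell_of size_map size_cell_of. Qed.

Lemma size_labels_border J kappa :
  size (labels_of J ++ border kappa) = #|{: label}|.
Proof.
by rewrite size_cat size_border size_labels_of card_label.
Qed.

(** A nonzero weight forces distinct labels, so points of one colour lie in distinct faces; the
    extra point conflicts with none of them. *)
Lemma is_cell_cell_of J kappa : weight J kappa != 0 -> is_cell ((None, 0) :: cell_of J).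
Proof.
move=> w_neq0; have : uniq (labels_of J).
  apply: contraNT w_neq0 => dup; rewrite /weight incidence_det_dup //.
    by rewrite size_labels_border.
  by rewrite cat_uniq (negPf dup).
move=> /injectiveP inj_J; apply/is_cellP => v w.
rewrite !inE => /predU1P[->|/mapP[t _ ->]] /predU1P[->|/mapP[t' _ ->]] //=.
rewrite /conflict /=; case: eqP => //= eq_t1; rewrite negbK.
case: (eqVneq t t') => [->|ne_t]; first by rewrite eqxx.
rewrite eq_sym eqbF_neg; apply: contra ne_t => /eqP eq_J.
by apply/eqP/inj_J; rewrite /= eq_J eq_t1.
Qed.

Lemma is_base_cell_cell_of J kappa : weight J kappa != 0 -> is_base_cell (cell_of J).
Proof.
move=> /is_cell_cell_of cell_J; apply/andP; split.
  by apply: is_cell_sub cell_J => v; rewrite inE orbC => ->.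
by apply/allP => _ /mapP[t _ ->].
Qed.

(** The passage between the two facets sharing the ridge opposite to [t]: the point moves to the
    free face of its colour, and [kappa] records the face it leaves. *)
Definition swap_at (t : color_index) (Jk : placement * {ffun 'I_d.+1 -> Zp}) :
    placement * {ffun 'I_d.+1 -> Zp} :=
  ([ffun l => [ffun i => if (l, i) == t then Jk.2 l else Jk.1 l i]],
   [ffun l => if l == t.1 then Jk.1 t.1 t.2 else Jk.2 l]).

Lemma swap_at_inv t : involutive (swap_at t).
Proof.
case=> J kappa; congr (_, _); apply/ffunP => l; rewrite !ffunE /=.
  apply/ffunP => i; rewrite !ffunE /=; case: eqP => [<-|//] /=.
  by rewrite eqxx.
by case: eqP => // ->; rewrite -surjective_pairing eqxx.
Qed.

Lemma weight_swap_at t Jk :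
  weight (swap_at t Jk).1 (swap_at t Jk).2 = - weight Jk.1 Jk.2.
Proof.
pose f (Jk : placement * {ffun 'I_d.+1 -> Zp}) (x : color_index + 'I_d.+1) :=
  match x with inl t => (t.1, Jk.1 t.1 t.2) | inr l => (l, Jk.2 l) end.
pose E : seq (color_index + 'I_d.+1) :=
  map inl (enum {: color_index}) ++ map inr (enum 'I_d.+1).
have mapE Jk' : map (f Jk') E = labels_of Jk'.1 ++ border Jk'.2.
  by rewrite map_cat -[X in X ++ _]map_comp -[X in _ ++ X]map_comp.
rewrite /weight -!mapE; apply: (@incidence_det_tperm _ _ _ _ _ _ _ (inl t) (inr t.1)).
- rewrite cat_uniq; apply/and3P; split.
  + by rewrite map_inj_uniq ?enum_uniq // => ? ? [].
  + by apply/hasPn => _ /mapP[l _ ->]; apply/mapP => -[].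
  by rewrite map_inj_uniq ?enum_uniq // => ? ? [].
- by rewrite -(size_map (f Jk)) mapE size_labels_border.
- by rewrite mem_cat map_f ?mem_enum.
- by rewrite mem_cat orbC map_f ?mem_enum.
- by [].
- by rewrite /= !ffunE -surjective_pairing eqxx.
- by rewrite /= !ffunE eqxx.
case=> [t'|l] /= ne_t ne_l; rewrite !ffunE //=.
  by rewrite -surjective_pairing ifN.
by rewrite ifN.
Qed.

Hypothesis two_neq0 : 2%:R != 0 :> F.

(** If [t] is the point of the deleted vertex, [swap_at t] preserves the remaining ridge and negates
    the weight. The sum for each position thus equals its negative. *)
Lemma fundamental_delta b : fundamental (delta b) = 0.
Proof.
rewrite /fundamental.
under eq_bigr => J _.
  under eq_bigr => kappa _.
    rewrite delta_index size_cell_of mulr_sumr.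
    over.
  rewrite exchange_big /=; over.
rewrite exchange_big big1 // => i _; rewrite pair_big /=.
set S := \sum_(_ | _) _; suff : S = - S.
  move/eqP; rewrite -addr_eq0 -mulr2n -mulr_natl mulf_eq0 (negPf two_neq0) /=.
  by move/eqP.
have lt_i : (i < #|{: color_index}|)%N by rewrite card_prod !card_ord.
have [t nth_t] : exists t, nth t (enum {: color_index}) i = t.
  exists (enum_val (Ordinal lt_i)).
  by rewrite -(enum_val_nth _ (Ordinal lt_i)).
rewrite {1}/S (reindex_inj (can_inj (swap_at_inv t))) /= -sumrN.
apply: eq_bigr => Jk _; rewrite weight_swap_at mulNr; congr (- (_ * (_ * b _))).
have cell_del J : take i (cell_of J) ++ drop i.+1 (cell_of J) =
    [seq (Some t, J t.1 t.2) |
       t <- take i (enum {: color_index}) ++ drop i.+1 (enum {: color_index})].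
  by rewrite map_cat map_take map_drop.
rewrite !cell_del; apply/eq_in_map => t' t'_E.
have ne_t' : t' != t.
  apply: contraL t'_E => /eqP->.
  have := enum_uniq {: color_index}.
  rewrite -{1}(cat_take_drop i (enum {: color_index})) (drop_nth t) -?cardE // nth_t uniq_catC.
  by rewrite cat_cons cons_uniq => /andP[+ _]; rewrite !mem_cat orbC.
by rewrite !ffunE -surjective_pairing (negPf ne_t').
Qed.

Lemma fundamental_shift m b :
  fundamental (fun s => b (map (shift m) s)) = fundamental b.
Proof.
pose sJ (J : placement) : placement := [ffun l => [ffun i => J l i + m]].
pose sk (kappa : {ffun 'I_d.+1 -> Zp}) := [ffun l => kappa l + m].
have inj_sJ : injective sJ.
  move=> J J' /ffunP eqJ; apply/ffunP => l; apply/ffunP => i.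
  by have /ffunP/(_ i) := eqJ l; rewrite !ffunE => /addIr.
have inj_sk : injective sk.
  by move=> k k' /ffunP eqk; apply/ffunP => l; have := eqk l; rewrite !ffunE => /addIr.
rewrite [RHS]/fundamental (reindex_inj inj_sJ); apply: eq_bigr => J _.
rewrite [RHS](reindex_inj inj_sk); apply: eq_bigr => kappa _; congr (_ * b _).
  rewrite /weight -(@det_shift _ _ _ odd_r m (labels_of J ++ _)) ?size_labels_border //.
  congr (det _); rewrite map_cat; congr (_ ++ _); rewrite -[LHS]map_comp;
  by apply: eq_map => x; rewrite /= /shift !ffunE.
by rewrite -[LHS]map_comp; apply: eq_map => t; rewrite /= /shift !ffunE.
Qed.

(** Only the terms with zero [kappa] survive, and they are squares of signs. They equal 1 when each
    colour is placed injectively into the faces other than 0, which leaves r factorial choices per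
    colour. *)
Lemma fundamental_facet :
  fundamental (fun s => facet_cochain F (fun=> 0) (map color_label s)) =
  r`!%:R ^+ d.+1.
Proof.
pose good (g : {ffun 'I_r -> Zp}) := injectiveb g && (g \in ffun_on [pred k | k != 0]).
have -> : r`!%:R ^+ d.+1 = \sum_(J : placement) \prod_l (good (J l))%:R :> F.
  rewrite -(bigA_distr_bigA (fun l g => (good g)%:R)) /= prodr_const card_ord.
  congr (_ ^+ _); rewrite -natr_sum; congr (_%:R).
  have := card_inj_ffuns_on 'I_r [pred k : Zp | k != 0].
  have -> : #|[pred k : Zp | k != 0]| = r by rewrite (cardC1 (0 : Zp)) card_ord.
  rewrite card_ord ffactnn => <-.
  rewrite -sum1dep_card big_mkcond; apply: eq_bigr => g _.
  by rewrite /good andbC; case: ifP.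
rewrite /fundamental; apply: eq_bigr => J _.
rewrite (bigD1 [ffun=> 0]) //= map_color_label_cell_of.
have size0 : size (labels_of J ++ border (fun=> 0)) = #|{: label}|.
  by rewrite size_cat size_border size_labels_of card_label.
have w0 : weight J [ffun=> 0] = det (labels_of J ++ border (fun=> 0)).
  by congr (det (_ ++ _)); apply: eq_map => l; rewrite ffunE.
rewrite w0 /facet_cochain.
have [uniqJ|dupJ] := boolP (uniq (labels_of J ++ border (fun=> 0))).
  have J_border l : (l, 0) \notin labels_of J.
    move: uniqJ; rewrite cat_uniq => /and3P[_ /hasPn/(_ (l, 0)) + _]; apply.
    by apply/mapP; exists l; rewrite ?mem_enum.
  rewrite incidence_det_uniq // big1 ?addr0 => [|kappa ne_kappa].
    rewrite big1 // => l _; rewrite /good (_ : injectiveb _) /=; last first.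
      apply/injectiveP => i i' eq_i.
      have /injectiveP inj_J : injectiveb (fun t => (t.1, J t.1 t.2) : label).
        by move: uniqJ; rewrite cat_uniq => /and3P[].
      have : (l, i) = (l, i') by apply: inj_J; rewrite /= eq_i.
      by case.
    rewrite (_ : _ \in _) //; apply/ffun_onP => i /=.
    apply: contraNneq (J_border l) => <-; apply/mapP; exists (l, i) => //.
    by rewrite mem_enum.
  have [l kl] : exists l, kappa l != 0.
    apply/existsP; apply: contraR ne_kappa => /existsPn kappa0; apply/eqP/ffunP => l.
    by rewrite ffunE; apply/eqP/negbNE/kappa0.
  rewrite /weight (@incidence_det_miss _ _ _ (l, 0)) ?mul0r ?size_labels_border //.
  rewrite mem_cat negb_or J_border; apply/mapP => -[l' _ [<- kl0]].
  by rewrite -kl0 eqxx in kl.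
rewrite incidence_det_dup // mulr0 big1 ?addr0 => [|kappa _]; last by rewrite mulr0.
have [l bad_l] : exists l, ~~ good (J l).
  apply/existsP; apply: contraR dupJ => /existsPn good_J.
  have {}good_J l i : (J l i != 0) && injectiveb (J l).
    by have /negbNE/andP[-> /ffun_onP/(_ i)] := good_J l; rewrite andbT.
  rewrite cat_uniq; apply/and3P; split.
  - apply/injectiveP => -[l i] [l' i'] eq_li.
    have /= eq_l := congr1 fst eq_li; have := congr1 snd eq_li.
    rewrite /= -eq_l => eq_J; have /andP[_ /injectiveP inj_J] := good_J l i.
    by rewrite (inj_J _ _ eq_J).
  - apply/hasPn => _ /mapP[l _ ->]; apply/mapP => -[[l' i] _ eq_l].
    have /andP[/eqP J0 _] := good_J l' i.
    by apply: J0; rewrite -[RHS]/((l, 0 : Zp).2) eq_l.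
  by rewrite map_inj_uniq ?enum_uniq // => l l' /(congr1 fst).
by rewrite (bigD1 l) //= (negPf bad_l) mul0r.
Qed.

Section Contradiction.
Hypotheses (rS_eq0 : r.+1%:R = 0 :> F) (fact_neq0 : r`!%:R != 0 :> F).
Variable phi : cochain label -> cochain vertex.
Hypothesis phi_local : forall a b s,
  is_cell s -> (size s <= (d.+1 * r).+1)%N ->
  (forall u, no_full_column u -> size u = size s -> a u = b u) ->
  phi a s = phi b s.
Hypothesis phiB : forall a b s,
  phi (fun u => a u - b u) s = phi a s - phi b s.
Hypothesis phi_sum : forall (I : finType) (a : I -> cochain label) s,
  phi (fun u => \sum_i a i u) s = \sum_i phi (a i) s.
Hypothesis phi_delta : forall a s, phi (delta a) s = delta (phi a) s.
Hypothesis phi_shift : forall m a s, is_cell s ->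
  phi (fun u => a (map (shift m) u)) s = phi a (map (shift m) s).
Hypothesis phi_nil : forall a, phi a [::] = a [::].

(** The coboundary of [phi alpha] vanishes on the cone with apex [(None, 0)] over a facet. Hence on
    facets [phi alpha] is the coboundary of the cochain obtained by prefixing the apex. *)
Let fundamental_phi : fundamental (phi (facet_cochain F (fun=> 0))) = 0.
Proof.
set alpha := facet_cochain _ _.
rewrite -[RHS](fundamental_delta (fun s => phi alpha ((None, 0) :: s))).
rewrite /fundamental; apply: eq_bigr => J _; apply: eq_bigr => kappa _.
have [->|w_neq0] := eqVneq (weight J kappa) 0; first by rewrite !mul0r.
congr (_ * _); apply/eqP; rewrite -subr_eq0; apply/eqP.
rewrite -/(delta (phi alpha) ((None, 0) :: cell_of J)) -phi_delta.
rewrite (@phi_local _ (fun u => 0 - 0)); first by rewrite phiB subrr.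
- exact: is_cell_cell_of w_neq0.
- by rewrite /= size_cell_of.
move=> u nf size_u; rewrite subrr; apply: delta_facet_cochain => //.
by rewrite size_u /= size_cell_of.
Qed.

(** By [ladder_top], [theta] takes the facet cochain to a coboundary plus a norm. The fundamental
    cycle gives 0 on the former and a multiple of [r.+1], zero in [F], on the latter; yet the value
    is minus a power of r factorial. *)
Lemma no_equivariant_chain_map : False.
Proof.
have N_gt0 : (0 < d.+1 * r)%N by rewrite muln_gt0.
pose L s := is_base_cell s && (size s <= d.+1 * r)%N.
pose theta a s := phi a s - a (map color_label s).
have [||||||||b [c theta_alpha]] :=
    @ladder_top F d r odd_r _ L theta _ _ _ _ _ _ _ _ N_gt0.
- move=> s u us /andP[/andP[cell_s /allP some_s] size_s].
  rewrite /L /is_base_cell (is_cell_sub (mem_subseq us)) //.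
  rewrite (leq_trans (size_subseq us)) // andbT.
  by apply/allP => v /(mem_subseq us)/some_s.
- move=> m s /andP[/andP[cell_s some_s] size_s].
  by rewrite /L /is_base_cell is_cell_shift // all_map size_map size_s andbT.
- move=> a b s /andP[base_s size_s] eq_ab; have /andP[cell_s _] := base_s.
  rewrite /theta (phi_local cell_s (leqW size_s) eq_ab) eq_ab ?size_map //.
  exact: color_label_no_full_column.
- by move=> a b s; rewrite /theta phiB !opprD !opprK addrACA.
- by move=> I a s; rewrite /theta phi_sum sumrB.
- by move=> a s; rewrite /theta phi_delta deltaB delta_map.
- move=> m a s /andP[/andP[cell_s _] _]; rewrite /theta phi_shift //; congr (_ - a _).
  by rewrite -!map_comp; apply: eq_map.
- by move=> a; rewrite /theta phi_nil subrr.
set alpha := facet_cochain _ _ in theta_alpha.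
have : fundamental (theta alpha) = - r`!%:R ^+ d.+1.
  rewrite -fundamental_facet -[RHS]add0r -fundamental_phi /fundamental -sumrB.
  apply: eq_bigr => J _; rewrite -sumrB; apply: eq_bigr => kappa _.
  by rewrite -mulrBr.
have -> : fundamental (theta alpha) = 0.
  transitivity (fundamental (delta b) +
      \sum_(m : Zp) fundamental (fun s => c (map (shift m) s))).
    rewrite /fundamental [X in _ = _ + X]exchange_big -big_split; apply: eq_bigr => J _ /=.
    rewrite [X in _ = _ + X]exchange_big -big_split; apply: eq_bigr => kappa _ /=.
    have [->|w_neq0] := eqVneq (weight J kappa) 0.
      by rewrite !mul0r big1 ?addr0 // => m _; rewrite mul0r.
    rewrite theta_alpha ?size_cell_of // ?mulrDr ?mulr_sumr //.
    by rewrite /L size_cell_of leqnn (is_base_cell_cell_of w_neq0).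
  rewrite fundamental_delta add0r.
  under eq_bigr do rewrite fundamental_shift.
  by rewrite sumr_const card_ord -mulr_natl rS_eq0 mul0r.
by move/eqP; rewrite eq_sym oppr_eq0 expf_eq0 (negPf fact_neq0) andbF.
Qed.

End Contradiction.

End ConfigurationComplex.

(** * Barycentric subdivision *)

Section Subdivision.
Variables (F : fieldType) (R : realFieldType) (m : nat).
Local Notation point := 'rV[R]_m.
Local Notation cochain := (seq point -> F).

Definition barycenter (s : seq point) : point :=
  (size s)%:R^-1 *: \sum_(x <- s) x.

Definition barycenter_closed (C : point -> Prop) : Prop :=
  forall s, s != [::] -> (forall x, x \in s -> C x) -> C (barycenter s).

(** Points of [u] arise from those of [s] by repeated barycenters; the impredicative form transfers
    any barycenter-closed property at once. *)
Definition in_hull (s u : seq point) : Prop :=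
  forall C, barycenter_closed C ->
    (forall x, x \in s -> C x) -> forall x, x \in u -> C x.

Definition mesh_le (e : R) (s : seq point) : Prop :=
  forall x y, x \in s -> y \in s -> forall i, `|x 0 i - y 0 i| <= e.

(* Barycentric subdivision, acting on cochains: the pieces of [s] are the cones
   with apex [barycenter s] over the pieces of the facets of [s]. *)
Fixpoint sd_rec (n : nat) (a : cochain) (s : seq point) : F :=
  if n is n'.+1 then delta (sd_rec n' (fun u => a (barycenter s :: u))) s
  else a s.

Definition sd (a : cochain) (s : seq point) : F := sd_rec (size s) a s.

Lemma sd_ext a b s : a =1 b -> sd a s = sd b s.
Proof.
rewrite /sd; move: (size s) => n; elim: n a b s => //= n IHn a b s eq_ab.
by apply: delta_ext => u _ _; apply: IHn.
Qed.

Lemma sdB a b s : sd (fun u => a u - b u) s = sd a s - sd b s.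
Proof.
rewrite /sd; move: (size s) => n; elim: n a b s => //= n IHn a b s.
by rewrite -deltaB; apply: delta_ext => u _ _; rewrite -IHn.
Qed.

Lemma sd_sum (I : finType) (a : I -> cochain) s :
  sd (fun u => \sum_i a i u) s = \sum_i sd (a i) s.
Proof.
rewrite /sd; move: (size s) => n; elim: n a s => //= n IHn a s.
by rewrite -delta_sum; apply: delta_ext => u _ _; rewrite -IHn.
Qed.

(** Induction on the size. With [b] the barycenter, [delta a'] on [b :: u] is [a' u - delta ab u];
    the second term disappears by induction, because [delta] squares to zero. *)
Lemma sd_delta a s : sd (delta a) s = delta (sd a) s.
Proof.
suff sd_rec_delta n a' s' : size s' = n.+1 ->
    sd_rec n.+1 (delta a') s' = delta (sd_rec n a') s'.
  case: s => [//|x s]; rewrite /sd sd_rec_delta //; apply: delta_ext => u _ /=.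
  by case=> ->.
elim: n a' s' => [|n IHn] a' s' size_s.
  by case: s' size_s => [//|x [|//]] _ /=; rewrite !subr0.
set b := barycenter s'; set ab := fun u => a' (b :: u).
have -> : sd_rec n.+2 (delta a') s' =
    delta (fun u => sd_rec n.+1 a' u - sd_rec n.+1 (delta ab) u) s'.
  rewrite [LHS]/=; apply: delta_ext => u _ _.
  have sd_recB k a1 a2 w : sd_rec k (fun v => a1 v - a2 v) w =
      sd_rec k a1 w - sd_rec k a2 w.
    elim: k a1 a2 w => //= k IHk a1 a2 w.
    by rewrite -deltaB; apply: delta_ext => v _ _; rewrite -IHk.
  by rewrite -[LHS]/(sd_rec n.+1 (fun v => a' v - delta ab v) u) sd_recB.
rewrite deltaB -[RHS]subr0; congr (_ - _).
rewrite (@delta_ext _ _ _ (delta (sd_rec n ab))) ?delta_delta // => u _.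
by rewrite size_s => -[size_u]; apply: IHn.
Qed.

Lemma sd_map (g : point -> point) a s :
  (forall u, g (barycenter u) = barycenter (map g u)) ->
  sd (fun u => a (map g u)) s = sd a (map g s).
Proof.
move=> gb; rewrite /sd size_map; move: (size s) => n; elim: n a s => //= n IHn a s.
rewrite -delta_map; apply: delta_ext => u _ _.
by rewrite -IHn gb.
Qed.

Lemma barycenter_coord s i :
  barycenter s 0 i = (size s)%:R^-1 * \sum_(x <- s) x 0 i.
Proof. by rewrite mxE summxE. Qed.

Lemma size_gt0_neq0 (s : seq point) : s != [::] -> (size s)%:R != 0 :> R.
Proof. by rewrite pnatr_eq0; case: s. Qed.

Lemma dist_barycenter_le s (y : point) i : s != [::] ->
  `|barycenter s 0 i - y 0 i| <= (size s)%:R^-1 * \sum_(x <- s) `|x 0 i - y 0 i|.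
Proof.
move=> s_neq0; rewrite barycenter_coord.
have yE : y 0 i = (size s)%:R^-1 * \sum_(x <- s) y 0 i.
  rewrite big_const_seq count_predT iter_addr_0.
  rewrite -[y 0 i *+ _]mulr_natl mulrA mulVf ?mul1r //.
  exact: size_gt0_neq0.
rewrite {1}yE -mulrBr normrM ger0_norm ?invr_ge0 ?ler0n // ler_wpM2l ?invr_ge0 ?ler0n //.
by rewrite -sumrB; apply: ler_norm_sum.
Qed.

Lemma barycenter_closed_ball (z : point) e :
  barycenter_closed (fun y => forall i, `|y 0 i - z 0 i| <= e).
Proof.
move=> s s_neq0 s_e i; apply: le_trans (dist_barycenter_le _ _ s_neq0) _.
rewrite ler_pdivrMl; last by rewrite lt0r size_gt0_neq0 // ler0n.
rewrite mulr_natl -(count_predT s) -iter_addr_0 -big_const_seq.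
by rewrite !big_seq; apply: ler_sum => x xs; apply: s_e.
Qed.

(** Subdividing a simplex with at most [M.+1] vertices shrinks the mesh by the factor [M / M.+1];
    this is expressed through the values of [a] on which [sd a s] depends. *)
Lemma sd_local M (a b : cochain) s e : (size s <= M.+1)%N -> mesh_le e s ->
  (forall u, size u = size s -> in_hull s u ->
    mesh_le (M%:R / M.+1%:R * e) u -> a u = b u) ->
  sd a s = sd b s.
Proof.
set rho := _ / _ => size_sM mesh_s eq_ab; rewrite /sd.
have [n size_s] : exists n, size s = n by exists (size s).
rewrite size_s; elim: n => [|n IHn] in a b s size_s size_sM mesh_s eq_ab *.
  apply: eq_ab => //; first by move=> C _.
  by move=> x y; rewrite (size0nil size_s).
have s_neq0 : s != [::] by case: (s) size_s.
have e_ge0 (i : 'I_m) : 0 <= e.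
  case: (s) s_neq0 mesh_s => // x s' _ /(_ x x (mem_head _ _) (mem_head _ _) i).
  by rewrite subrr normr0.
have rho_ge0 : 0 <= rho by rewrite divr_ge0 ?ler0n.
(* In the average of the distances to [x] the term of [x] itself is zero, whence the factor
   [n / n.+1], at most [rho]. *)
have vertex_dist x : x \in s -> forall i, `|barycenter s 0 i - x 0 i| <= rho * e.
  move=> xs i; apply: le_trans (dist_barycenter_le _ _ s_neq0) _.
  rewrite (big_rem x) //= subrr normr0 add0r.
  apply: le_trans (_ : (size s)%:R^-1 * (n%:R * e) <= _).
    rewrite ler_wpM2l ?invr_ge0 ?ler0n //.
    rewrite -[n]/(n.+1.-1) -size_s -(size_rem xs) mulr_natl -(count_predT (rem x s)).
    rewrite -iter_addr_0 -big_const_seq !big_seq.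
    by apply: ler_sum => y /mem_rem ys; apply: mesh_s.
  rewrite mulrA ler_wpM2r ?(e_ge0 i) // mulrC ler_pdivrMr ?size_s ?ltr0n //.
  rewrite mulrAC ler_pdivlMr ?ltr0n // -!natrM ler_nat.
  by move: size_sM; rewrite size_s ltnS; nia.
rewrite /=; apply: delta_ext => u u_s; rewrite size_s => -[size_u].
have u_sub := mem_subseq u_s.
apply: IHn => // [||v size_v hull_v mesh_v].
- by rewrite size_u -ltnS -size_s ltnW.
- by move=> x y xu yu; apply: mesh_s; apply: u_sub.
(* Balls are closed under barycenters, so the bound passes from the vertices of [u] to those of
   [v]. *)
have bary_v y : y \in v -> forall i, `|y 0 i - barycenter s 0 i| <= rho * e.
  move=> yv; apply: (hull_v _ (@barycenter_closed_ball (barycenter s) (rho * e))) y yv.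
  by move=> x /u_sub xs i; rewrite distrC; apply: vertex_dist.
apply: eq_ab.
- by rewrite /= size_v size_u size_s.
- move=> C C_closed C_s x; rewrite inE => /predU1P[->|xv]; first exact: C_closed.
  by apply: hull_v xv => // y /u_sub; apply: C_s.
move=> x y; rewrite !inE => /predU1P[->|xv] /predU1P[->|yv] i.
- by rewrite subrr normr0 mulr_ge0 ?(e_ge0 i).
- by rewrite distrC; apply: bary_v.
- exact: bary_v.
exact: mesh_v.
Qed.

Lemma in_hull_trans s u v : in_hull s u -> in_hull u v -> in_hull s v.
Proof. by move=> su uv C C_closed C_s; apply: uv => //; apply: su. Qed.

Lemma iter_sd_local k M (a b : cochain) s e : (size s <= M.+1)%N -> mesh_le e s ->
  (forall u, size u = size s -> in_hull s u ->
    mesh_le ((M%:R / M.+1%:R) ^+ k * e) u -> a u = b u) ->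
  iter k sd a s = iter k sd b s.
Proof.
elim: k s e => [|k IHk] s e size_s mesh_s eq_ab.
  by apply: eq_ab => //; [move=> C _ | rewrite expr0 mul1r].
rewrite !iterS; apply: (sd_local size_s mesh_s) => u size_u hull_u mesh_u.
apply: (IHk u _ _ mesh_u) => [|v size_v hull_v mesh_v]; first by rewrite size_u.
apply: eq_ab; first by rewrite size_v.
  exact: in_hull_trans hull_v.
by rewrite exprSr -mulrA.
Qed.

Lemma iter_sd_ext k a b s : a =1 b -> iter k sd a s = iter k sd b s.
Proof. by move=> eq_ab; elim: k s => //= k IHk s; apply: sd_ext. Qed.

Lemma iter_sdB k a b s :
  iter k sd (fun u => a u - b u) s = iter k sd a s - iter k sd b s.
Proof. by elim: k s => //= k IHk s; rewrite -sdB; apply: sd_ext. Qed.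

Lemma iter_sd_sum k (I : finType) (a : I -> cochain) s :
  iter k sd (fun u => \sum_i a i u) s = \sum_i iter k sd (a i) s.
Proof. by elim: k s => //= k IHk s; rewrite -sd_sum; apply: sd_ext. Qed.

Lemma iter_sd_delta k a s : iter k sd (delta a) s = delta (iter k sd a) s.
Proof. by elim: k s => //= k IHk s; rewrite -sd_delta; apply: sd_ext. Qed.

Lemma iter_sd_map k (g : point -> point) a s :
  (forall u, g (barycenter u) = barycenter (map g u)) ->
  iter k sd (fun u => a (map g u)) s = iter k sd a (map g s).
Proof. by move=> gb; elim: k s => //= k IHk s; rewrite -sd_map //; apply: sd_ext. Qed.

Lemma iter_sd_nil k a : iter k sd a [::] = a [::].
Proof. by elim: k. Qed.

End Subdivision.

(** * The space of configurations *)

Lemma cvg_sumr (R : realType) (V : normedModType R) (T : Type)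
    (F : set_system T) (FF : Filter F) (I : finType) (P : pred I)
    (f : I -> T -> V) (l : I -> V) :
  (forall i, P i -> f i x @[x --> F] --> l i) ->
  \sum_(i | P i) f i x @[x --> F] --> \sum_(i | P i) l i.
Proof. by move=> fl; apply: cvg_big fl; apply: add_continuous. Qed.

Section Configurations.
Variables (R : realType) (d r : nat).
Local Notation Zp := 'I_r.+1.
Local Notation label := ('I_d.+1 * 'I_r.+1)%type.
Local Notation vertex := (option ('I_d.+1 * 'I_r) * 'I_r.+1)%type.
Local Notation point := 'rV[R]_#|{: option ('I_d.+1 * 'I_r) * 'I_r.+1}|.

Definition coord (x : point) (v : vertex) : R := x 0 (enum_rank v).

Lemma coord_ext (x y : point) : (forall v, coord x v = coord y v) -> x = y.
Proof.
move=> eq_xy; apply/rowP => i; have := eq_xy (enum_val i).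
by rewrite /coord enum_valK.
Qed.

(** The realization of the complex of cells in barycentric coordinates; vanishing products express a
    conflict-free support as a closed condition. *)
Definition configuration : set point := [set x |
  [/\ forall v, 0 <= coord x v, \sum_v coord x v = 1 &
      forall v w, conflict v w -> coord x v * coord x w = 0]].

Lemma coord_le1 x v : configuration x -> coord x v <= 1.
Proof.
case=> x_ge0 <- _; rewrite (bigD1 v) //= lerDl.
by apply: sumr_ge0 => w _; apply: x_ge0.
Qed.

Lemma continuous_coord v : continuous (coord^~ v).
Proof. by move=> x; apply: coord_continuous. Qed.

Lemma continuous_sum_coord (P : pred vertex) :
  continuous (fun x => \sum_(v | P v) coord x v).
Proof.
move=> x; apply: (@cvg_sumr R R^o _ (nbhs x) (nbhs_filter x)) => v _.
exact: continuous_coord.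
Qed.

Lemma configuration_closed : closed configuration.
Proof.
have -> : configuration =
    \bigcap_v (coord^~ v @^-1` [set y | 0 <= y]) `&`
    ((fun x => \sum_v coord x v) @^-1` [set y | y = 1] `&`
     \bigcap_(vw in [set vw | conflict vw.1 vw.2])
       ((fun x => coord x vw.1 * coord x vw.2) @^-1` [set y | y = 0])).
  apply/seteqP; split=> x.
    case=> x_ge0 x_sum x_conf; split; first by move=> v _; apply: x_ge0.
    by split=> // -[v w] /= vw; apply: x_conf.
  case=> x_ge0 [x_sum x_conf]; split=> [v||v w vw]; [exact: x_ge0|exact: x_sum|].
  exact: (x_conf (v, w)).
apply: closedI.
  apply: closed_bigI => v _; apply: (preimage_closed _ (@closed_ge R 0)) => x _.
  exact: continuous_coord.
apply: closedI.
  apply: (preimage_closed _ (@closed_eq R 1)) => x _; exact: continuous_sum_coord.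
apply: closed_bigI => -[v w] _; apply: (preimage_closed _ (@closed_eq R 0)) => x _.
exact: (cvgM (@continuous_coord v x) (@continuous_coord w x)).
Qed.

Lemma configuration_compact : compact configuration.
Proof.
have cube_compact : compact
    [set x : point | forall i, [set` `[0 : R, 1]] (x ord0 i)].
  apply: (@rV_compact _ _ (fun=> [set` `[0 : R, 1]])) => _.
  exact: segment_compact.
apply: subclosed_compact configuration_closed cube_compact _ => x Kx i /=.
rewrite in_itv /= -(enum_valK i); have := Kx => -[x_ge0 _ _].
by apply/andP; split; [exact: x_ge0|exact: coord_le1].
Qed.

Definition shift_point (m : Zp) (x : point) : point :=
  \row_i coord x (shift (- m) (enum_val i)).

Lemma coord_shift_point m x v : coord (shift_point m x) v = coord x (shift (- m) v).
Proof. by rewrite {1}/coord mxE enum_rankK. Qed.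

Lemma shift_pointD m k x : shift_point m (shift_point k x) = shift_point (k + m) x.
Proof.
apply: coord_ext => v; rewrite !coord_shift_point shiftD; congr (coord x (shift _ v)).
by rewrite opprD addrC.
Qed.

Lemma shift_point_barycenter m u :
  shift_point m (barycenter u) = barycenter (map (shift_point m) u).
Proof.
apply: coord_ext => v; rewrite coord_shift_point /coord !barycenter_coord.
rewrite size_map big_map; congr (_ * _); apply: eq_bigr => x _.
by rewrite -[RHS]/(coord _ _) coord_shift_point.
Qed.

Definition vertex_point (v : vertex) : point := delta_mx 0 (enum_rank v).

Lemma coord_vertex_point v w : coord (vertex_point v) w = (w == v)%:R.
Proof. by rewrite /coord mxE eqxx (inj_eq enum_rank_inj). Qed.

Lemma shift_vertex_point m v :
  shift_point m (vertex_point v) = vertex_point (shift m v).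
Proof.
apply: coord_ext => w; rewrite coord_shift_point !coord_vertex_point.
rewrite -(inj_eq (@shift_inj _ _ m)) shiftD addNr.
by rewrite shift0.
Qed.

Lemma in_hull_cell s u x : is_cell s ->
  in_hull (map vertex_point s) u -> x \in u -> configuration x.
Proof.
move=> /is_cellP cell_s hull_u xu.
(* The face spanned by [s], which is closed under barycenters. *)
pose C x := [/\ forall v, 0 <= coord x v, \sum_v coord x v = 1 &
  forall v, v \notin s -> coord x v = 0].
suff [x_ge0 x_sum x_supp] : C x.
  split=> // v w vw; have [vs|/x_supp->] := boolP (v \in s); last by rewrite mul0r.
  have [ws|/x_supp->] := boolP (w \in s); last by rewrite mulr0.
  by have := cell_s _ _ vs ws; rewrite vw.
apply: hull_u xu => [t t_neq0 tC|_ /mapP[v vs ->]]; split.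
- move=> v; rewrite /coord barycenter_coord mulr_ge0 ?invr_ge0 ?ler0n // big_seq.
  by apply: sumr_ge0 => y /tC[y_ge0 _ _]; apply: y_ge0.
- under eq_bigr do rewrite /coord barycenter_coord.
  rewrite -mulr_sumr exchange_big /= big_seq (eq_bigr (fun=> 1)); last first.
    by move=> y /tC[_ y_sum _].
  by rewrite -big_seq big_const_seq count_predT iter_addr_0 mulVf ?size_gt0_neq0.
- move=> v v_s; rewrite /coord barycenter_coord big_seq big1 ?mulr0 // => y /tC[_ _].
  exact.
- by move=> w; rewrite coord_vertex_point ler0n.
- rewrite (bigD1 v) //= coord_vertex_point eqxx big1 ?addr0 // => w ne_w.
  by rewrite coord_vertex_point (negPf ne_w).
by move=> w w_s; rewrite coord_vertex_point; case: eqP vs w_s => // -> ->.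
Qed.

Lemma mesh_vertex_points s : mesh_le 1 (map vertex_point s).
Proof.
move=> _ _ /mapP[v _ ->] /mapP[w _ ->] i; rewrite !mxE !eqxx.
by case: eqP; case: eqP => _ _; rewrite ?subrr ?subr0 ?sub0r ?normrN ?normr1 ?normr0.
Qed.

(** An equivariant but discontinuous choice of a row: the selection of [t] ignores rows, and in a
    configuration [t] has weight in one row only. *)
Definition row_of (x : point) : Zp :=
  if [pick t | [exists k, coord x (t, k) != 0]] is Some t then
    odflt 0 [pick k | coord x (t, k) != 0]
  else 0.

Lemma row_of_shift m x : configuration x ->
  row_of (shift_point m x) = row_of x + m.
Proof.
case=> x_ge0 x_sum x_conf; rewrite /row_of.
have coordE t k : coord (shift_point m x) (t, k) = coord x (t, k - m).
  by rewrite coord_shift_point.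
have -> : [pick t | [exists k, coord (shift_point m x) (t, k) != 0]] =
          [pick t | [exists k, coord x (t, k) != 0]].
  apply: eq_pick => t; apply/existsP/existsP => -[k tk].
    by exists (k - m); rewrite -coordE.
  by exists (k + m); rewrite coordE addrK.
case: pickP => [t /existsP[k0 tk0]|x0].
  case: pickP => [k tk|/(_ (k0 + m))]; last by rewrite coordE addrK tk0.
  case: pickP => [k' tk' /=|/(_ k0)]; last by rewrite tk0.
  rewrite coordE in tk; apply/eqP; rewrite -subr_eq; apply: contraT => ne_k.
  have : conflict (t, k - m) (t, k').
    by case: (t) => [t'|]; rewrite /conflict /= ?eqxx ?ne_k // eq_sym (negPf ne_k).
  by move/x_conf/eqP; rewrite mulf_eq0 (negPf tk) (negPf tk').
have := oner_neq0 R; rewrite -x_sum big1 ?eqxx // => -[t k] _.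
by have /existsPn/(_ k)/negbNE/eqP := negbT (x0 t).
Qed.

End Configurations.

(** * Zeros of equivariant test maps *)

Section TestMap.
Variables (R : realType) (d r : nat).
Hypotheses (r_ge2 : (2 <= r)%N) (prime_r : prime r.+1).
Local Notation Zp := 'I_r.+1.
Local Notation label := ('I_d.+1 * 'I_r.+1)%type.
Local Notation vertex := (option ('I_d.+1 * 'I_r) * 'I_r.+1)%type.
Local Notation point := 'rV[R]_#|{: option ('I_d.+1 * 'I_r) * 'I_r.+1}|.
Local Notation configuration := (@configuration R d r).

Variable Phi : 'I_d.+1 -> Zp -> point -> R.
Hypothesis Phi_cvg : forall l k y, configuration y ->
  Phi l k x @[x --> within configuration (nbhs y)] --> Phi l k y.
Hypothesis Phi_shift : forall m l k x, configuration x ->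
  Phi l (k + m) (shift_point m x) = Phi l k x.

(** A continuous, shift-invariant quantity that vanishes exactly when column [l] is constant. *)
Let variation l x := \sum_k \sum_k' (Phi l k x - Phi l k' x) ^+ 2.

Let variation_gt0 l k k' x : Phi l k x != Phi l k' x -> 0 < variation l x.
Proof.
rewrite -subr_eq0 => ne_k; rewrite /variation (bigD1 k) //= (bigD1 k') //=.
rewrite -addrA ltr_pwDl ?exprn_even_gt0 ?ne_k ?orbT // addr_ge0 //.
  by apply: sumr_ge0 => j _; apply: sqr_ge0.
by apply: sumr_ge0 => j _; apply: sumr_ge0 => j' _; apply: sqr_ge0.
Qed.

Let variation_cvg l y : configuration y ->
  variation l x @[x --> within configuration (nbhs y)] --> variation l y.
Proof.
move=> Ky; apply: (@cvg_sumr R R^o) => k _; apply: (@cvg_sumr R R^o) => k' _.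
by rewrite expr2; apply: cvgM; apply: cvgB; apply: Phi_cvg.
Qed.

Let variation_shift m l x : configuration x ->
  variation l (shift_point m x) = variation l x.
Proof.
move=> Kx; rewrite [LHS](reindex_inj (@addIr _ m)); apply: eq_bigr => k _.
rewrite (reindex_inj (@addIr _ m)); apply: eq_bigr => k' _.
by rewrite !Phi_shift.
Qed.

Let base_label (x : point) : label :=
  let l := [arg max_(l > ord0 : 'I_d.+1) variation l x]%O in
  (l, [arg max_(k > ord0 : Zp) Phi l k x]%O).

(* The maximizing column is canonical, but ties between rows are broken
   equivariantly by means of [row_of]. *)
Definition label_of (x : point) : label :=
  shift (row_of x) (base_label (shift_point (- row_of x) x)).

Let label_of_shift m x : configuration x ->
  label_of (shift_point m x) = shift m (label_of x).
Proof.
move=> Kx; rewrite /label_of row_of_shift // shift_pointD shiftD.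
congr (shift _ (base_label _)).
by rewrite opprD addrCA subrr addr0.
Qed.

Let variation_label_of l x : configuration x ->
  variation l x <= variation (label_of x).1 x.
Proof.
move=> Kx; rewrite /label_of /base_label /=; case: arg_maxP => //= l' _.
by move/(_ l isT); rewrite !variation_shift.
Qed.

Let Phi_label_of k x : configuration x ->
  Phi (label_of x).1 k x <= Phi (label_of x).1 (label_of x).2 x.
Proof.
move=> Kx; rewrite /label_of /base_label /=.
set l := [arg max_(_ > _) _]%O; case: arg_maxP => //= k' _.
move/(_ (k - row_of x) isT); rewrite Phi_shift //.
by rewrite -(@Phi_shift (- row_of x) l (k' + row_of x)) // addrK.
Qed.

Let cvg_lt_near (f g : point -> R) (y : point) :
  f x @[x --> within configuration (nbhs y)] --> f y ->
  g x @[x --> within configuration (nbhs y)] --> g y -> f y < g y ->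
  \forall x \near y, configuration x -> f x < g x.
Proof.
move=> cf cg; rewrite -subr_gt0 => lt_fg.
have : \forall x \near within configuration (nbhs y), 0 < g x - f x.
  exact: cvgr_gt (cvgB cg cf) _ lt_fg.
rewrite near_withinE; apply: filterS => x lt_x /lt_x.
by rewrite subr_gt0.
Qed.

Section NoZero.
Hypothesis Phi_neq : forall y, configuration y ->
  exists l k k', Phi l k y != Phi l k' y.

(** If column [l] is not constant at [y], a row with a non-maximal value stays non-maximal nearby.
    If it is constant, some other column varies more near [y], and [l] is not chosen at all. *)
Let label_of_near l y : configuration y ->
  exists k, \forall x \near y, configuration x -> label_of x != (l, k).
Proof.
move=> Ky; have [[k [k' ne_k]]|const] := pselect (exists k k', Phi l k y != Phi l k' y).
  wlog lt_k : k k' ne_k / Phi l k y < Phi l k' y.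
    move=> wl; have [lt_k|lt_k|eq_k] := ltgtP (Phi l k y) (Phi l k' y).
    - exact: wl lt_k.
    - by apply: wl lt_k; rewrite eq_sym.
    - by rewrite eq_k eqxx in ne_k.
  exists k.
  have := cvg_lt_near (@Phi_cvg l k y Ky) (@Phi_cvg l k' y Ky) lt_k.
  apply: filterS => x lt_x Kx.
  apply/eqP => label_x.
  have := Phi_label_of k' Kx; rewrite label_x /= leNgt => /negP; apply.
  exact: lt_x.
have [l0 [k [k' ne_k]]] := Phi_neq Ky.
have var_l : variation l y = 0.
  apply: big1 => j _; apply: big1 => j' _; apply/eqP; rewrite sqrf_eq0 subr_eq0.
  by apply: contra_notT const => ne_j; exists j, j'.
have lt_l : variation l y < variation l0 y by rewrite var_l (variation_gt0 ne_k).
exists 0.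
have := cvg_lt_near (@variation_cvg l y Ky) (@variation_cvg l0 y Ky) lt_l.
apply: filterS => x lt_x Kx.
apply/eqP => label_x; have := variation_label_of l0 Kx.
by rewrite label_x /= leNgt => /negP; apply; apply: lt_x.
Qed.

(** A Lebesgue number argument: by compactness one mesh bound serves all the neighbourhoods of
    [label_of_near]. *)
Let label_of_small : exists2 e : R, 0 < e & forall s : seq point,
  (forall x, x \in s -> configuration x) -> mesh_le e s ->
  no_full_column (map label_of s).
Proof.
have /compact_near_coveringP := @configuration_compact R d r.
move=> /(_ R (0^'+) (fun e x => forall s : seq point,
  (forall y, y \in s -> configuration y) -> mesh_le e s -> x \in s ->
  no_full_column (map label_of s)) _) [].
  move=> y Ky.
  have /fin_all_exists[k near_k] l := label_of_near l Ky.
  have : \forall x \near y, forall l, configuration x -> label_of x != (l, k l).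
    exact: (@filter_forall _ _ (fun l x => configuration x -> label_of x != (l, k l))
      _ (nbhs_filter y) near_k).
  move=> /nbhs_ballP[e /= e_gt0 ball_e].
  (* Half of the radius is for the distance from [y] to [x], half for the mesh around [x]. *)
  exists (ball y (e / 2), [set e' | e' < e / 2]).
    split => /=; first by apply: nbhsx_ballx; rewrite divr_gt0.
    by apply: nbhs_right_lt; rewrite divr_gt0.
  move=> [x e'] /= [xy e'_lt] s sK mesh_s xs; apply/no_full_columnP => l.
  exists (k l); apply/mapP => -[z zs label_z].
  have /(_ l (sK _ zs)) : forall l, configuration z -> label_of z != (l, k l).
    apply: ball_e; rewrite (splitr e).
    apply: (@ball_triangle _ _ x) => //; split=> [|i j]; first by rewrite divr_gt0.
    rewrite -ball_normE /= ord1; apply: le_lt_trans e'_lt.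
    exact: mesh_s.
  by rewrite -label_z eqxx.
move=> e0 /= e0_gt0 small.
exists (e0 / 2); first by rewrite divr_gt0.
move=> s sK mesh_s; case: s sK mesh_s => [|x s] sK mesh_s.
  by apply/no_full_columnP => l; exists 0.
have Kx := sK x (mem_head x s).
apply: (small (e0 / 2) _ _ x) => //=; last exact: mem_head.
- by rewrite sub0r normrN ger0_norm ?divr_ge0 ?ltW // ltr_pdivrMr // ltr_pMr // ltr1n.
- by rewrite divr_gt0.
Qed.

Lemma no_nowhere_zero_test_map : False.
Proof.
have [e e_gt0 small] := label_of_small.
(* The largest cells considered, cones over facets, have [M.+1] vertices. *)
pose M := (d.+1 * r)%N; pose rho : R := M%:R / M.+1%:R.
have [K rho_le] : exists K, rho ^+ K <= e.
  have rho_lt1 : `|rho| < 1.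
    by rewrite ger0_norm ?divr_ge0 ?ler0n // ltr_pdivrMr ?ltr0n // mul1r ltr_nat.
  have [K _ /(_ K (leqnn K))] := cvgr_le _ (cvg_expr rho_lt1) _ e_gt0.
  by exists K.
have odd_p : odd r.+1.
  by have [r_eq1|//] := even_prime prime_r; move: r_ge2; case: r_eq1 => ->.
pose phi (a : seq label -> 'F_r.+1) (s : seq vertex) :=
  iter K (@sd _ _ _) (fun u => a (map label_of u)) (map (@vertex_point R d r) s).
have natr_neq0 n : ~~ (r.+1 %| n)%N -> n%:R != 0 :> 'F_r.+1.
  by rewrite -(dvdn_pcharf (pchar_Fp prime_r)).
have prime_ndvd_fact n : (n <= r)%N -> ~~ (r.+1 %| n`!)%N.
  elim: n => [|n IHn] le_n; first by rewrite dvdn1 eqSS -lt0n ltnW.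
  by rewrite factS Euclid_dvdM // negb_or IHn ?(ltnW le_n) // gtnNdvd.
apply: (@no_equivariant_chain_map 'F_r.+1 d r _ odd_p _ _ _ phi).
- exact: ltnW.
- by apply: natr_neq0; rewrite gtnNdvd.
- by apply/eqP; rewrite -(dvdn_pcharf (pchar_Fp prime_r)).
- exact/natr_neq0/prime_ndvd_fact.
- move=> a b s cell_s size_s eq_ab.
  apply: (@iter_sd_local _ _ _ K M _ _ _ 1); rewrite ?size_map //.
    exact: mesh_vertex_points.
  move=> u size_u hull_u mesh_u; apply: eq_ab; last by rewrite size_map.
  apply: small => [x xu|x y xu yu i]; first exact: in_hull_cell hull_u xu.
  by apply: le_trans rho_le; rewrite -[leRHS]mulr1; apply: mesh_u.
- by move=> a b s; apply: iter_sdB.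
- by move=> I a s; apply: iter_sd_sum.
- move=> a s; rewrite /phi; transitivity (delta
      (iter K (@sd _ _ _) (fun u => a (map label_of u))) (map (@vertex_point R d r) s)).
    by rewrite -iter_sd_delta; apply: iter_sd_ext => u; rewrite delta_map.
  by rewrite -delta_map.
- move=> m a s cell_s; rewrite /phi -map_comp.
  have -> : map (@vertex_point R d r \o shift m) s =
      map (shift_point m) (map (@vertex_point R d r) s).
    by rewrite -map_comp; apply: eq_map => v; rewrite /= shift_vertex_point.
  rewrite -(@iter_sd_map _ _ _ K (shift_point m)); last exact: shift_point_barycenter.
  (* Only membership in the cell is used here, not the mesh, so the size of [s] serves as bound. *)
  apply: (@iter_sd_local _ _ _ K (size s) _ _ _ 1); rewrite ?size_map //.
    exact: mesh_vertex_points.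
  move=> u _ hull_u _; congr a; rewrite -!map_comp; apply/eq_in_map => x xu /=.
  by rewrite label_of_shift //; apply: in_hull_cell hull_u xu.
by move=> a; rewrite /phi iter_sd_nil.
Qed.

End NoZero.

Theorem test_map_zero :
  exists2 y, configuration y & forall l k k', Phi l k y = Phi l k' y.
Proof.
apply: contrapT => no_zero; apply: no_nowhere_zero_test_map => y Ky.
apply: contrapT => all_eq; apply: no_zero; exists y => // l k k'.
by apply/eqP; apply: contra_notT all_eq => ne_k; exists l, k, k'.
Qed.

End TestMap.

(** * Convexity *)

Section Convexity.
Variables (R : realType) (n : nat).

Lemma convex_setP (A : set 'rV[R]_n) : @convex_set R 'rV[R]_n A <->
  forall x y t, A x -> A y -> 0 <= t -> t <= 1 -> A (t *: x + (1 - t) *: y).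
Proof.
split=> [cA x y t /mem_set Ax /mem_set Ay t_ge0 t_le1|cA x y t /set_mem Ax /set_mem Ay].
  by have /set_mem := cA x y (Itv01 t_ge0 t_le1) Ax Ay.
by apply/mem_set/cA.
Qed.

Lemma convex_set_sum (A : set 'rV[R]_n) (I : finType) (w : I -> R)
    (y : I -> 'rV[R]_n) :
  @convex_set R 'rV[R]_n A -> (forall i, 0 <= w i) -> \sum_i w i = 1 ->
  (forall i, w i != 0 -> A (y i)) -> A (\sum_i w i *: y i).
Proof.
move=> /convex_setP cA w_ge0 w_sum Ay.
(* Partial sums are normalized, so that those of positive weight are convex combinations
   themselves. *)
suff sumA (s : seq I) : 0 < \sum_(i <- s) w i ->
    A ((\sum_(i <- s) w i)^-1 *: \sum_(i <- s) w i *: y i).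
  by have := sumA (index_enum I); rewrite w_sum invr1 scale1r; apply.
elim: s => [|i s IHs]; first by rewrite big_nil ltxx.
rewrite !big_cons; set W := \sum_(j <- s) w j in IHs *; set S := \sum_(j <- s) _ in IHs *.
have [W0|W_neq0] := eqVneq W 0.
  have -> : S = 0.
    apply: big1_seq => j /andP[_ js].
    have /allP/(_ j js) : all (fun j => true ==> (w j == 0)) s.
      by rewrite -psumr_eq0 // -/W W0.
    by move=> /= /eqP->; rewrite scale0r.
  rewrite W0 !addr0 => wi_gt0; rewrite scalerA mulVf ?scale1r ?gt_eqF //.
  by apply: Ay; rewrite gt_eqF.
have W_gt0 : 0 < W by rewrite lt_def W_neq0 sumr_ge0.
move=> wW_gt0; have [wi0|wi_neq0] := eqVneq (w i) 0.
  by rewrite wi0 scale0r !add0r; apply: IHs.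
have := cA _ _ (w i / (w i + W)) (Ay i wi_neq0) (IHs W_gt0).
rewrite divr_ge0 ?(ltW wW_gt0) // ler_pdivrMr // mul1r lerDl (ltW W_gt0).
move=> /(_ isT isT); congr A; rewrite scalerDr !scalerA.
congr (_ *: _ + _ *: _); first by rewrite mulrC.
by field; rewrite W_neq0 gt_eqF.
Qed.

Variables (T : finType) (x : T -> 'rV[R]_n).

Lemma conv_of_sum (F : {set T}) (I : finType) (w : I -> R) (g : I -> T) :
  (forall i, 0 <= w i) -> \sum_i w i = 1 -> (forall i, w i != 0 -> g i \in F) ->
  conv_of x F (\sum_i w i *: x (g i)).
Proof.
move=> w_ge0 w_sum gF A [cA FA]; apply: convex_set_sum => // i /gF giF.
by apply: FA; exists (g i).
Qed.

Lemma conv_of_sub (F : {set T}) (A : set 'rV[R]_n) :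
  @convex_set R 'rV[R]_n A -> (forall t, t \in F -> A (x t)) ->
  conv_of x F `<=` A.
Proof. by move=> cA FA; apply: smallest_sub => // _ [t tF <-]; apply: FA. Qed.

End Convexity.

(** * A bounded injective function on the line *)

Section Squash.
Variable R : realType.

Definition squash (u : R) : R := u / (1 + `|u|).

Let den_gt0 (u : R) : 0 < 1 + `|u|.
Proof. by rewrite ltr_pwDl. Qed.

Lemma squash_norm_le1 u : `|squash u| <= 1.
Proof.
rewrite normrM normfV [`|1 + _|]ger0_norm ?(ltW (den_gt0 _)) //.
by rewrite ler_pdivrMr // mul1r lerDr.
Qed.

Lemma squash_inj : injective squash.
Proof.
(* This recovers the denominator from the value. *)
have norm_squash u : 1 - `|squash u| = (1 + `|u|)^-1.
  rewrite normrM normfV [`|1 + _|]ger0_norm ?(ltW (den_gt0 _)) //.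
  by rewrite -[X in X - _](@mulfV _ (1 + `|u|)) ?gt_eqF // -mulrBl addrK mul1r.
move=> u v eq_uv; have := norm_squash u; rewrite eq_uv norm_squash => /invr_inj eq_den.
by move: eq_uv; rewrite /squash eq_den => /mulIf; apply; rewrite invr_eq0 gt_eqF.
Qed.

Lemma squash_cvg (X : Type) (F : set_system X) (FF : Filter F) (f : X -> R) l :
  f x @[x --> F] --> l -> squash (f x) @[x --> F] --> squash l.
Proof.
move=> fl; apply: cvgM => //; apply: cvgV; first by rewrite gt_eqF.
by apply: cvgD; [apply: cvg_cst|apply: cvg_norm].
Qed.

End Squash.

(** * Rainbow faces *)

Section RainbowFaces.
Variables (R : realType) (d r : nat).
Hypotheses (r_ge2 : (2 <= r)%N) (prime_r : prime r.+1).
Local Notation Zp := 'I_r.+1.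
Local Notation color_index := ('I_d.+1 * 'I_r)%type.
Local Notation vertex := (option ('I_d.+1 * 'I_r) * 'I_r.+1)%type.
Local Notation point := 'rV[R]_#|{: option ('I_d.+1 * 'I_r) * 'I_r.+1}|.
Local Notation configuration := (@configuration R d r).

Variables (T : finType) (c : T -> 'I_d.+1) (n : nat) (v : T -> 'rV[R]_n).
Variable f : 'rV[R]_n -> 'rV[R]_d.
Hypothesis class_ge : forall i, (r <= #|color_class c i|)%N.
Hypothesis f_cont : {within conv_of v [set: T]%SET, continuous f}.

Let pt (t : color_index) : T := enum_val (widen_ord (class_ge t.1) t.2).

Let color_pt t : c (pt t) = t.1.
Proof.
by have := enum_valP (widen_ord (class_ge t.1) t.2); rewrite inE => /eqP.
Qed.

Let pt_inj : injective pt.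
Proof.
move=> [l i] [l' i'] eq_t; have := color_pt (l', i'); rewrite -eq_t color_pt /= => eq_l.
rewrite -eq_l in eq_t *; have /enum_val_inj/(congr1 val) /= eq_i := eq_t.
by congr (_, _); apply: val_inj.
Qed.

(** Only [total] counts the extra point, so the two weights agree on a face without it. *)
Let total (k : Zp) (x : point) := \sum_t coord x (t, k).
Let mass (k : Zp) (x : point) := \sum_(t : color_index) coord x (Some t, k).
Let bary (k : Zp) (x : point) :=
  \sum_(t : color_index) (coord x (Some t, k) / mass k x) *: v (pt t).

Let mass_ge0 k x : configuration x -> 0 <= mass k x.
Proof. by case=> x_ge0 _ _; apply: sumr_ge0 => t _; apply: x_ge0. Qed.

Let bary_conv k x (F : {set T}) : configuration x -> mass k x != 0 ->
  (forall t, coord x (Some t, k) != 0 -> pt t \in F) -> conv_of v F (bary k x).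
Proof.
move=> Kx mass_neq0 tF; apply: conv_of_sum => [t||t].
- by rewrite divr_ge0 ?mass_ge0 //; case: Kx => x_ge0 _ _; apply: x_ge0.
- by rewrite -mulr_suml mulfV.
by rewrite mulf_eq0 negb_or => /andP[/tF].
Qed.

(* At [mass = 0] the normalization in [bary] is void; boundedness of [squash]
   then makes the product continuous. *)
Let test_map (l : 'I_d.+1) (k : Zp) (x : point) : R :=
  if unlift ord0 l is Some i then mass k x * squash (f (bary k x) 0 i)
  else total k x.

Let coord_shiftD m (x : point) t k : coord (shift_point m x) (t, k + m) = coord x (t, k).
Proof. by rewrite coord_shift_point /shift /= addrK. Qed.

Let test_map_shift m l k (x : point) : test_map l (k + m) (shift_point m x) = test_map l k x.
Proof.
have mass_shift : mass (k + m) (shift_point m x) = mass k x.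
  by apply: eq_bigr => t _; rewrite coord_shiftD.
rewrite /test_map; case: (unlift _ _) => [i|].
  rewrite mass_shift; congr (_ * squash (f _ _ _)); apply: eq_bigr => t _.
  by rewrite mass_shift coord_shiftD.
by apply: eq_bigr => t _; rewrite coord_shiftD.
Qed.

Let coord_cvg w (y : point) :
  coord x w @[x --> within configuration (nbhs y)] --> coord y w.
Proof. apply: cvg_within_filter; exact: continuous_coord. Qed.

Let mass_cvg k (y : point) :
  mass k x @[x --> within configuration (nbhs y)] --> mass k y.
Proof. by apply: (@cvg_sumr R R^o) => t _; apply: coord_cvg. Qed.

Let bary_cvg k (y : point) : mass k y != 0 ->
  bary k x @[x --> within configuration (nbhs y)] --> bary k y.
Proof.
move=> mass_neq0; apply: cvg_sumr => t _; apply: cvgZr_tmp; apply: cvgM => //.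
by apply: cvgV => //; apply: mass_cvg.
Qed.

Let test_map_cvg l k (y : point) : configuration y ->
  test_map l k x @[x --> within configuration (nbhs y)] --> test_map l k y.
Proof.
move=> Ky; rewrite /test_map; case: (unlift _ _) => [i|]; last first.
  by apply: (@cvg_sumr R R^o) => t _; apply: coord_cvg.
have mass_k := @mass_cvg k y; have [mass0|mass_neq0] := eqVneq (mass k y) 0.
  rewrite mass0 mul0r; rewrite mass0 in mass_k.
  apply: (@squeeze_cvgr _ _ _ _ (fun x => - mass k x) (mass k)) => //; last first.
    by rewrite -oppr0; apply: cvgN.
  rewrite near_withinE; apply: filterE => x Kx; rewrite -ler_norml normrM.
  by rewrite ger0_norm ?mass_ge0 // ler_piMr ?mass_ge0 // squash_norm_le1.
apply: cvgM => //; apply: squash_cvg.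
pose C := conv_of v [set: T]%SET.
have Cy : C (bary k y) by apply: bary_conv => // t _; rewrite inE.
have f_cvg : f u @[u --> within C (nbhs (bary k y))] --> f (bary k y).
  by move/subspace_continuousP : f_cont; apply.
apply: (@cvg_comp _ _ _ (fun x => f (bary k x)) (fun z : 'rV[R]_d => z 0 i)).
  2: exact: coord_continuous.
apply: cvg_comp f_cvg => W W_near.
(* Continuity of [f] is given only within the simplex, so nearby values of [bary] must be shown to
   stay in it. *)
have near_C : \forall x \near within configuration (nbhs y), C (bary k x).
  have : \forall x \near within configuration (nbhs y), 0 < mass k x.
    by apply: cvgr_gt mass_k _ _; rewrite lt_def mass_neq0 mass_ge0.
  rewrite !near_withinE; apply: filterS => x mass_gt0 Kx.
  by apply: bary_conv => //; rewrite gt_eqF ?mass_gt0.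
have near_W : \forall x \near within configuration (nbhs y), C (bary k x) -> W (bary k x).
  exact: (@bary_cvg k y mass_neq0 _ W_near).
by apply: filterS2 near_C near_W => x Cx; apply.
Qed.

Lemma rainbow_faces : exists F : 'I_r -> {set T}, disjoint_rainbow c F /\
  \bigcap_(j in [set: 'I_r]) (f @` conv_of v (F j)) !=set0.
Proof.
have [y Ky y_zero] : exists2 y, configuration y &
    forall l k k', test_map l k y = test_map l k' y.
  by apply: test_map_zero.
have [y_ge0 y_sum y_conf] := Ky.
(* Column [ord0] makes the [r.+1] totals equal, and they add up to 1. *)
have total_eq k : total k y = r.+1%:R^-1.
  apply: (mulfI (_ : r.+1%:R != 0)); first by rewrite pnatr_eq0.
  rewrite mulfV ?pnatr_eq0 // -[RHS]y_sum.
  rewrite (eq_bigr (fun v => coord y (v.1, v.2))); last by case.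
  rewrite -(pair_bigA _ (fun t k => coord y (t, k))) exchange_big /=.
  rewrite (eq_bigr (fun=> total k y)) => [|k' _]; last first.
    by have := y_zero ord0 k' k; rewrite /test_map unlift_none.
  by rewrite sumr_const card_ord mulr_natl.
(* The face of the extra point, or an arbitrary one if that point has no weight, is dropped;
   [lift k0] enumerates the other [r]. *)
have [k0 k0P] : exists k0, forall k, k != k0 -> coord y (None, k) = 0.
  have [k0 nz|all0] := pickP (fun k => coord y (None, k) != 0); last first.
    by exists 0 => k _; have /negbFE/eqP := all0 k.
  exists k0 => k ne_k; have := y_conf (None, k) (None, k0) ne_k.
  by move/eqP; rewrite mulf_eq0 (negPf nz) orbF => /eqP.
have mass_eq (j : 'I_r) : mass (lift k0 j) y = r.+1%:R^-1.
  rewrite -(total_eq (lift k0 j)) /total (bigD1 None) //= k0P ?add0r; last first.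
    by rewrite eq_sym neq_lift.
  rewrite (reindex_omap Some id) /=; last by case.
  by apply: eq_bigl => t; rewrite eqxx.
have mass_neq0 j : mass (lift k0 j) y != 0 by rewrite mass_eq invr_eq0 pnatr_eq0.
pose F (j : 'I_r) : {set T} :=
  [set pt t | t in [pred t | coord y (Some t, lift k0 j) != 0]]%SET.
have r_gt0 : (0 < r)%N by apply: ltnW.
pose j0 := Ordinal r_gt0.
exists F; split; first split.
- move=> j j' ne_j; apply/pred0Pn => -[_ /andP[/= /imsetP[t tj ->]]].
  case/imsetP=> t' tj' /pt_inj eq_t.
  rewrite -eq_t !inE in tj tj'.
  have := y_conf (Some t, lift k0 j) (Some t, lift k0 j').
  rewrite /conflict /= !eqxx (inj_eq lift_inj) (negPf ne_j) => /(_ isT)/eqP.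
  by rewrite mulf_eq0 (negPf tj) (negPf tj').
- move=> i j; apply/card_le1_eqP => z z'.
  rewrite !inE => /andP[/eqP cz /imsetP[t tj zt]] 
    /andP[/eqP cz' /imsetP[t' tj' zt']].
  rewrite !inE in tj tj'.
  have eq_l : t.1 = t'.1 by rewrite -!color_pt -zt -zt' cz.
  rewrite zt zt'; congr pt; apply/eqP; apply: contraT => ne_t.
  have := y_conf (Some t, lift k0 j) (Some t', lift k0 j).
  rewrite /conflict /= eq_l !eqxx [t == t']eq_sym (negPf ne_t) => /(_ isT)/eqP.
  by rewrite mulf_eq0 (negPf tj) (negPf tj').
exists (f (bary (lift k0 j0) y)) => j _; exists (bary (lift k0 j) y).
  apply: bary_conv => // t t_nz; apply/imsetP; exists t => //.
(* Equal nonzero masses cancel in the remaining columns, and [squash] is injective. *)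
apply/rowP => i; have := y_zero (lift ord0 i) (lift k0 j) (lift k0 j0).
rewrite /test_map liftK !mass_eq => /mulfI; rewrite invr_eq0 pnatr_eq0 => /(_ isT).
exact: squash_inj.
Qed.

End RainbowFaces.

(** * The affine case and the lower bound *)

Lemma colored_tverberg_of_topological (R : realType) (d r t : nat) :
  topological_colored_tverberg R d r t -> colored_tverberg R d r t.
Proof.
move=> top T c x class_ge.
(* The given points are the images of the vertices of a standard simplex under a linear map. *)
pose v (i : T) : 'rV[R]_#|T| := delta_mx 0 (enum_rank i).
pose X : 'M[R]_(#|T|, d) := \matrix_(i, j) x (enum_val i) 0 j.
have vX i : v i *m X = x i by rewrite -rowE; apply/rowP => j; rewrite !mxE enum_rankK.
have indep_v : affinely_independent v.
  move=> a _ /rowP av0 i; have := av0 (enum_rank i).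
  rewrite summxE (bigD1 i) //= big1 ?addr0 => [|j ne_j].
    by rewrite !mxE !eqxx mulr1.
  by rewrite !mxE eqxx (inj_eq enum_rank_inj) eq_sym (negPf ne_j) mulr0.
have cont_X : {within conv_of v [set: T]%SET, continuous (fun u => u *m X)}.
  apply: continuous_subspaceT => u; rewrite (_ : (fun u => u *m X) =
      fun u : 'rV[R]_#|T| => \sum_i u 0 i *: row i X).
    apply: (@cvg_sumr R _ _ (nbhs u) (nbhs_filter u)) => i _; apply: cvgZr_tmp.
    exact: coord_continuous.
  by apply/funext => w; rewrite mulmx_sum_row.
have [F [F_rainbow [z zF]]] := top T c _ v _ indep_v class_ge cont_X.
exists F; split=> //; exists z => j jr; have [u uF <-] := zF j jr.
move: u uF; apply: conv_of_sub => [|i iF]; last first.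
  by rewrite vX => A [_]; apply; exists i.
apply/convex_setP => u w k Au Aw k_ge0 k_le1.
rewrite mulmxDl -!scalemxAl => A cA.
by move/convex_setP: (cA.1); apply=> //; [apply: Au|apply: Aw].
Qed.

(** Class [i] consists of [t] copies of the [i]-th vertex of a simplex. A common point has a nonzero
    barycentric coordinate [i], so each of the [r] disjoint faces needs its own point of colour
    [i]. *)
Lemma colored_tverberg_ge (R : realType) (d r t : nat) :
  colored_tverberg R d r t -> (r <= t)%N.
Proof.
pose x (i : 'I_d.+1 * 'I_t) : 'rV[R]_d :=
  if unlift ord0 i.1 is Some j then delta_mx 0 j else 0.
have card_class i : #|color_class (fst : 'I_d.+1 * 'I_t -> 'I_d.+1) i| = t.
  rewrite (_ : color_class _ _ = finset.setX [set i]%SET [set: 'I_t]%SET).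
    by rewrite cardsX cards1 cardsT card_ord mul1n.
  by apply/setP => -[l j]; rewrite !inE andbT.
move=> /(_ _ fst x) [i|F [[F_disj F_rainbow] [z zF]]]; first by rewrite card_class.
(* Barycentric coordinates with respect to these vertices; their sum is 1, so they do not all
   vanish. *)
pose b (i : 'I_d.+1) (u : 'rV[R]_d) : R :=
  if unlift ord0 i is Some j then u 0 j else 1 - \sum_j u 0 j.
have [i bi_z] : exists i, b i z != 0.
  apply/existsP; apply: contraT => /existsPn b0; have := b0 ord0.
  rewrite /b unlift_none big1 ?subr0 ?oner_eq0 // => j _.
  by have := b0 (lift ord0 j); rewrite /b liftK negbK => /eqP.
have meet j : exists k, k \in F j /\ k.1 = i.
  apply: contrapT => no_k; suff /eqP : b i z = 0 by rewrite (negPf bi_z).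
  (* The hull of points of other colours lies in the convex set where this coordinate vanishes. *)
  apply: (conv_of_sub (A := [set u | b i u = 0])) (zF j I) => [|k kF].
    apply/convex_setP => u w k /= bu bw _ _; move: bu bw; rewrite /b.
    case: unliftP => [l _|_]; first by rewrite !mxE => -> ->; rewrite !mulr0 addr0.
    move=> /eqP; rewrite subr_eq0 => /eqP bu /eqP; rewrite subr_eq0 => /eqP bw.
    rewrite (eq_bigr (fun j => k * u 0 j + (1 - k) * w 0 j)) => [|l _]; last first.
      by rewrite !mxE.
    by rewrite big_split /= -!mulr_sumr -bu -bw !mulr1 addrC subrK subrr.
  have k_i : k.1 != i by apply/eqP => k_i; apply: no_k; exists k.
  rewrite /= /b /x; case: unliftP k_i => [l ->|->]; case: unliftP => [l' ->|->] ne_l.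
  - by rewrite mxE eqxx eq_sym -(inj_eq (@lift_inj _ ord0)) (negPf ne_l).
  - by rewrite mxE.
  - rewrite (bigD1 l') //= mxE !eqxx big1 ?addr0 ?subrr // => l ne_l'.
    by rewrite mxE eqxx (negPf ne_l').
  by rewrite eqxx in ne_l.
have [k kP] := fin_all_exists meet.
have k_inj : injective k.
  move=> j j' eq_k; apply/eqP; apply: contraT => ne_j.
  have /pred0P/(_ (k j)) := F_disj j j' ne_j.
  by rewrite /= (kP j).1 eq_k (kP j').1.
have <- : #|k @: [set: 'I_r]%SET| = r by rewrite card_imset // cardsT card_ord.
apply: leq_trans (eq_leq (card_class i)).
apply/subset_leq_card/fintype.subsetP => _ /imsetP[j _ ->].
by rewrite inE (kP j).2.
Qed.

Theorem corollary2p3 (R : realType) (d r : nat)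
    (hd : (1 <= d)%N) (hr : (2 <= r)%N) (hp : prime r.+1) :
  is_t R d r r /\ is_tt R d r r.
Proof.
have top : topological_colored_tverberg R d r r.
  by move=> T c n v f _ class_ge f_cont; apply: rainbow_faces.
split; split=> //.
- exact: colored_tverberg_of_topological.
- by move=> t; apply: colored_tverberg_ge.
by move=> t /colored_tverberg_of_topological; apply: colored_tverberg_ge.
Qed.
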